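(* The problem Timeline Dominating Set is NP-hard, even when restricted to instances with $T=35$, $k=3$, $\ell=6$, and maximum snapshot degree at most one.
   Context: A temporal graph $\mathcal{G}=(G_1,\dots,G_T)$ is a finite sequence of simple undirected graphs (snapshots) on a common finite vertex set $V$; $T$ is its lifetime. A temporal vertex is a pair $(v,i)$ with $v\in V$, $i\in\{1,\dots,T\}$. An activity interval is a triple $(v,a,b)$ with $v\in V$, $a,b\in\{1,\dots,T\}$, $a\le b$; its length is $b-a$. A $k$-activity $\ell$-timeline is a set of activity intervals containing at most $k$ intervals for each vertex, each of length at most $\ell$. A vertex $v$ is active at time $i$ if the timeline contains some $(v,a,b)$ with $a\le i\le b$. The timeline dominates the temporal vertex $(v,i)$ if $v$ lies in the closed neighborhood $N_{G_i}[u]$ of some vertex $u$ active at time $i$. The maximum snapshot degree is $\max_i\Delta(G_i)$. Timeline Dominating Set: given $\mathcal{G}$ and integers $k\ge1$, $\ell\ge0$, decide whether there is a $k$-activity $\ell$-timeline dominating all temporal vertices of $\mathcal{G}$. *)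

(* Defs.v *)
From Corelib Require Import BinNums.
From mathcomp Require Import all_boot ssralg poly.

Set Implicit Arguments.
Unset Strict Implicit.
Unset Printing Implicit Defensive.

(** * Multi-tape Turing machines, NP and NP-hardness *)

Inductive move := MoveLeft | Stay | MoveRight.

(* [None] is the blank, [Some (inl b)] the input/output letter [b], and
   [Some (inr a)] an auxiliary work letter. *)
Definition symbol (aux : finType) : Type := option (bool + aux).

(* Nondeterministic machine with [extra_tapes.+1] tapes: [trans q r] lists the
   available actions in state [q] when the symbols under the heads are [r]; the
   machine halts when the list is empty. *)
Record machine := Machine {
  extra_tapes : nat;
  state : finType;
  aux : finType;
  start : state;
  accepting : pred state;
  trans : state -> {ffun 'I_extra_tapes.+1 -> symbol aux} ->
          seq (state * {ffun 'I_extra_tapes.+1 -> symbol aux * move})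
}.

(* Two-way infinite tape [(l, r)]: [l] is the content left of the head, nearest
   cell first, and [r] the content from the head cell on; all the cells beyond
   [l] and [r] are blank. *)
Definition tape (aux : finType) : Type := (seq (symbol aux) * seq (symbol aux))%type.

Definition read (aux : finType) (t : tape aux) : symbol aux := head None t.2.

Definition write_move (aux : finType) (t : tape aux) (a : symbol aux * move) :
    tape aux :=
  let l := t.1 in
  let r := behead t.2 in
  match a.2 with
  | MoveLeft => (behead l, [:: head None l, a.1 & r])
  | Stay => (l, a.1 :: r)
  | MoveRight => (a.1 :: l, r)
  end.

Definition config (M : machine) : Type :=
  (state M * {ffun 'I_(extra_tapes M).+1 -> tape (aux M)})%type.

Definition successors (M : machine) (c : config M) : seq (config M) :=
  [seq (a.1, [ffun i => write_move (c.2 i) ((a.2 : {ffun _ -> _}) i)])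
     | a <- trans c.1 [ffun i => read (c.2 i)]].

Definition step (M : machine) : rel (config M) := fun c c' => c' \in successors c.

Definition halted (M : machine) (c : config M) : bool := nilp (successors c).

Definition word (aux : finType) (x : seq bool) : seq (symbol aux) :=
  [seq Some (inl b) | b <- x].

Definition init (M : machine) (x : seq bool) : config M :=
  (start M, [ffun i => ([::], if i == ord0 then word (aux M) x else [::])]).

(* [s] lists the successive configurations after the initial one, so that
   [size s] is the number of steps. *)
Definition computation (M : machine) (x : seq bool) (s : seq (config M)) : bool :=
  path (@step M) (init M x) s.

Definition accepts (M : machine) (x : seq bool) : Prop :=
  exists s : seq (config M),
    [/\ computation x s, halted (last (init M x) s)
      & accepting (last (init M x) s).1].

Definition deterministic (M : machine) : Prop :=
  forall q r, size (@trans M q r) <= 1.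

(* The output is read on the first tape, from the head rightwards. *)
Definition outputs (M : machine) (c : config M) (y : seq bool) : Prop :=
  exists m : nat, (c.2 ord0).2 = word (aux M) y ++ nseq m None.

(* Every computation, whatever its nondeterministic choices, has at most
   [p.[size x]] steps. *)
Definition NP (L : seq bool -> Prop) : Prop :=
  exists (M : machine) (p : {poly nat}),
    (forall x (s : seq (config M)), computation x s -> size s <= (p.[size x])%R)
    /\ (forall x, L x <-> accepts M x).

Definition polytime_computable (f : seq bool -> seq bool) : Prop :=
  exists (M : machine) (p : {poly nat}),
    deterministic M /\
    forall x, exists s : seq (config M),
      [/\ computation x s, halted (last (init M x) s),
          size s <= (p.[size x])%R & outputs (last (init M x) s) (f x)].

Record problem := Problem {
  instance : Type;
  encode : instance -> seq bool;
  yes : instance -> Prop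
}.

Definition restrict (P : problem) (R : instance P -> Prop) : problem :=
  @Problem {I : instance P | R I} (fun I => encode (sval I))
           (fun I => yes (sval I)).

(* The reduction has to produce an encoding of an instance of [P] on every
   input. *)
Definition NP_hard (P : problem) : Prop :=
  forall L : seq bool -> Prop, NP L ->
  exists2 f : seq bool -> seq bool, polytime_computable f &
    forall x, exists I : instance P, f x = encode I /\ (L x <-> yes I).

(** * Timeline Dominating Set *)

(* The times [1, ..., T] are represented by ['I_T], i.e. shifted by one. *)
Record temporal_graph (V : finType) (T : nat) := TemporalGraph {
  adj : 'I_T -> rel V;
  adj_sym : forall i, symmetric (adj i);
  adj_irr : forall i, irreflexive (adj i)
}.

Section Timelines.
Variables (V : finType) (T : nat).

(* [(v, a, b)] stands for the activity interval of [v] from [a] to [b]. *)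
Definition triple : finType := (V * 'I_T * 'I_T)%type.

Definition activity_interval (x : triple) : bool := x.1.2 <= x.2.

Definition interval_length (x : triple) : nat := x.2 - x.1.2.

Definition is_timeline (k ell : nat) (S : {set triple}) : Prop :=
  [/\ forall x, x \in S -> activity_interval x,
      forall x, x \in S -> interval_length x <= ell
    & forall v : V, #|[set x in S | x.1.1 == v]| <= k].

Definition active (S : {set triple}) (v : V) (i : 'I_T) : Prop :=
  exists a b : 'I_T, (v, a, b) \in S /\ a <= i <= b.

Variable G : temporal_graph V T.

Definition closed_neighborhood (i : 'I_T) (u : V) : {set V} :=
  [set v | (v == u) || adj G i u v].

Definition dominates (S : {set triple}) (v : V) (i : 'I_T) : Prop :=
  exists u : V, active S u i /\ v \in closed_neighborhood i u.

Definition max_snapshot_degree : nat :=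
  \max_(i < T) \max_(v : V) #|[set u | adj G i v u]|.

End Timelines.

Record tds_instance := TDSInstance {
  nvertices : nat;
  lifetime : nat;
  graph : temporal_graph 'I_nvertices lifetime;
  activity : nat;
  maxlen : nat;
  activity_gt0 : 0 < activity
}.

Definition tds_yes (I : tds_instance) : Prop :=
  exists S : {set triple 'I_(nvertices I) (lifetime I)},
    is_timeline (activity I) (maxlen I) S /\
    forall v i, dominates (graph I) S v i.

Definition unary (n : nat) : seq bool := rcons (nseq n true) false.

Fixpoint pos_bits (p : positive) : seq bool :=
  match p with
  | xH => [:: true]
  | xO q => false :: pos_bits q
  | xI q => true :: pos_bits q
  end.

(* Self-delimiting binary code: every bit is preceded by [true], and [false]
   ends the code. *)
Definition binary (n : nat) : seq bool :=
  rcons (flatten [seq [:: true; b] | b <- if bin_of_nat n is Npos p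
                                          then pos_bits p else [::]]) false.

(* The snapshots are given by their adjacency matrices; this already takes
   [lifetime * nvertices ^ 2] bits, hence the two sizes may be written in unary. *)
Definition tds_encode (I : tds_instance) : seq bool :=
  unary (nvertices I) ++ unary (lifetime I) ++
  binary (activity I) ++ binary (maxlen I) ++
  flatten [seq [seq adj (graph I) i u v | u <- enum 'I_(nvertices I),
                                          v <- enum 'I_(nvertices I)]
             | i <- enum 'I_(lifetime I)].

Definition TimelineDominatingSet : problem :=
  @Problem tds_instance tds_encode tds_yes.

(* Main.v *)
Require Import Defs.
From mathcomp Require Import all_boot ssralg poly zify.
From Stdlib Require Import FunctionalExtensionality.

Set Implicit Arguments.
Unset Strict Implicit.
Unset Printing Implicit Defensive.

(** A language in NP is first described by tilings of a polynomial rectangle (the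
    space-time diagrams of the machine), and the tilings by a CNF formula, given as
    the table of the occurrences of the variables in the clauses.

    In a snapshot of maximum degree one, the pair [u, w] of an edge is dominated iff
    [u] or [w] is active, and an isolated vertex iff it is active itself. Three
    intervals of length at most 6 cannot meet four times that are pairwise at
    distance at least 7, so the times 0, 7, 14 and 21 are four obligations of which
    a vertex fulfils at most three. Each entry [(m, v)] of the table gets four
    vertices. Two copies [P], [Q] of the variable [v], isolated at 0 and 7, choose
    between 14 and {21, 22}; the edges [P - Q] at 22 and [Q - P] at 14 along a cycle
    through all the clauses make the choices consistent. The clause [m] is a path of
    vertices [C] isolated at 0 and linked at the times 7 and 14; each of them
    must also cover 21 unless a true literal does so, and a counting argument along
    the path shows that one of the literals must be true.

    The remaining slots must be left free: every such vertex gets five suppliers,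
    the [r]-th one being active in the blocks r, r+1, r+2 modulo 5 of the five
    blocks of seven times. At each time three suppliers are active; two of them
    cover the two inactive ones and the third one is available.

    The reduction is computed by a machine whose tapes are used as stacks, obtained
    from a program that evaluates arithmetic expressions in unary for each entry of
    the adjacency matrices. *)

(** * Stack programs and their compilation to Turing machines *)

Inductive cmd :=
| Skip
| Push of nat & bool
| Pop of nat
| Case of nat & cmd & cmd & cmd
| Seq of cmd & cmd
| While of nat & cmd.

Notation "c1 ;; c2" := (Seq c1 c2) (at level 61, right associativity).

Definition store := nat -> seq bool.

Definition upd (s : store) r w : store := fun r' => if r' == r then w else s r'.

(** The last argument is the exact number of steps of the compiled machine. A push counts 2: the
    head first moves left, then writes. A sequence adds nothing, the exit of its first command being
    the entrance to the second. *)
Inductive exec : cmd -> store -> store -> nat -> Prop :=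
| ExSkip s : exec Skip s s 1
| ExPush r b s : exec (Push r b) s (upd s r (b :: s r)) 2
| ExPop r s : exec (Pop r) s (upd s r (behead (s r))) 1
| ExCaseNil r c0 cf ct s s' n :
    s r = [::] -> exec c0 s s' n -> exec (Case r c0 cf ct) s s' n.+1
| ExCaseCons r c0 cf ct s s' n b w :
    s r = b :: w -> exec (if b then ct else cf) s s' n ->
    exec (Case r c0 cf ct) s s' n.+1
| ExSeq c1 c2 s1 s2 s3 n1 n2 :
    exec c1 s1 s2 n1 -> exec c2 s2 s3 n2 -> exec (Seq c1 c2) s1 s3 (n1 + n2)
| ExWhileNil r c s : s r = [::] -> exec (While r c) s s 1
| ExWhileCons r c s1 s2 s3 n1 n2 :
    s1 r <> [::] -> exec c s1 s2 n1 -> exec (While r c) s2 s3 n2 ->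
    exec (While r c) s1 s3 (n1 + n2).+1.

Fixpoint max_reg (c : cmd) : nat :=
  match c with
  | Skip => 0
  | Push r _ => r
  | Pop r => r
  | Case r a b d => maxn r (maxn (max_reg a) (maxn (max_reg b) (max_reg d)))
  | Seq a b => maxn (max_reg a) (max_reg b)
  | While r a => maxn r (max_reg a)
  end.

(** In [Case] and [While] the state [None] tests the register; the two states of [Push] are its two
    steps. *)
Fixpoint cstate (c : cmd) : finType :=
  match c with
  | Skip => unit
  | Push _ _ => bool
  | Pop _ => unit
  | Case _ a b d => option (cstate a + cstate b + cstate d)%type
  | Seq a b => (cstate a + cstate b)%type
  | While _ a => option (cstate a)
  end.

Fixpoint cstart (c : cmd) : cstate c :=
  match c return cstate c with
  | Skip => tt
  | Push _ _ => true
  | Pop _ => tt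
  | Case _ a b d => None
  | Seq a b => inl (cstart a)
  | While _ a => None
  end.

Notation sym := (symbol void).

Definition action := option (nat * (sym * move)).

(* The next state is [None] when control leaves the command; the action
   concerns one tape, the other ones being left unchanged. *)
Fixpoint ctrans (c : cmd) : cstate c -> (nat -> sym) -> option (cstate c) * action :=
  match c return cstate c -> (nat -> sym) -> option (cstate c) * action with
  | Skip => fun _ _ => (None, None)
  | Push r b => fun q rd =>
      if q then (Some false, Some (r, (rd r, MoveLeft)))
      else (None, Some (r, (Some (inl b), Stay)))
  | Pop r => fun _ _ => (None, Some (r, (None, MoveRight)))
  | Case r a b d => fun q rd =>
      match q with
      | None =>
        (Some (Some (match rd r with
                     | Some (inl true) => inr (cstart d)
                     | Some (inl false) => inl (inr (cstart b))
                     | _ => inl (inl (cstart a))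
                     end)), None)
      | Some (inl (inl q)) =>
        let (q', act) := ctrans q rd in (omap (fun z => Some (inl (inl z))) q', act)
      | Some (inl (inr q)) =>
        let (q', act) := ctrans q rd in (omap (fun z => Some (inl (inr z))) q', act)
      | Some (inr q) =>
        let (q', act) := ctrans q rd in (omap (fun z => Some (inr z)) q', act)
      end
  | Seq a b => fun q rd =>
      match q with
      | inl q => let (q', act) := ctrans q rd in
                 (Some (if q' is Some z then inl z else inr (cstart b)), act)
      | inr q => let (q', act) := ctrans q rd in (omap inr q', act)
      end
  | While r a => fun q rd =>
      match q with
      | None => (if rd r is Some _ then Some (Some (cstart a)) else None, None)
      | Some q => let (q', act) := ctrans q rd in (Some q', act)
      end
  end.

Section Compile.
Variable k : nat.

Notation tapes := {ffun 'I_k.+1 -> tape void}.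

Definition reads_at (rd : {ffun 'I_k.+1 -> sym}) (r : nat) : sym := rd (inord r).

Definition actions (rd : {ffun 'I_k.+1 -> sym}) (act : action) :
    {ffun 'I_k.+1 -> sym * move} :=
  [ffun i : 'I_k.+1 => if act is Some (r, a) then
               if i == r :> nat then a else (rd i, Stay) else (rd i, Stay)].

Definition all_reads (tp : tapes) : {ffun 'I_k.+1 -> sym} := [ffun i => read (tp i)].

Definition perform (tp : tapes) (act : action) : tapes :=
  [ffun i => write_move (tp i) (actions (all_reads tp) act i)].

Definition cnext c (q : cstate c) (tp : tapes) : option (cstate c) * tapes :=
  let (q', act) := ctrans q (reads_at (all_reads tp)) in (q', perform tp act).

Inductive reach c : cstate c -> tapes -> nat -> tapes -> Prop :=
| ReachExit q tp tp' : cnext q tp = (None, tp') -> reach q tp 1 tp'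
| ReachStep q tp q1 tp1 n tp' :
    cnext q tp = (Some q1, tp1) -> reach q1 tp1 n tp' -> reach q tp n.+1 tp'.

(** The states of a subcommand embed by [f] in those of the command around it, and [g] tells where
    its exit leads: to a state, or out of the whole command. *)
Lemma reach_sim c c' (f : cstate c -> cstate c') (g : option (cstate c'))
    q tp n tp' :
  (forall q rd, ctrans (f q) rd =
     ((if (ctrans q rd).1 is Some z then Some (f z) else g), (ctrans q rd).2)) ->
  reach q tp n tp' ->
  if g is Some q' then forall m tp2, reach q' tp' m tp2 -> reach (f q) tp (n + m) tp2
  else reach (f q) tp n tp'.
Proof.
move=> fE; elim=> {q tp n tp'} [q tp tp' | q tp q1 tp1 n tp'].
  rewrite /cnext; case E: (ctrans _ _) => [q' act] [eq' etp]; subst q'.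
  case: g fE => [q'|] fE.
    move=> m tp2 H; rewrite add1n; apply: ReachStep H.
    by rewrite /cnext fE E /= etp.
  by apply: ReachExit; rewrite /cnext fE E /= etp.
rewrite /cnext; case E: (ctrans _ _) => [q' act] [eq' etp] _; subst q'.
case: g fE => [q'|] fE IH.
  move=> m tp2 /IH H; rewrite addSn; apply: ReachStep H.
  by rewrite /cnext fE E /= etp.
by apply: ReachStep IH; rewrite /cnext fE E /= etp.
Qed.

(** The top of the stack is under the head. Popped cells are erased on the left, and blanks may
    accumulate on the right, as [outputs] permits. *)
Definition rep (t : tape void) (w : seq bool) : Prop :=
  all (pred1 None) t.1 /\ exists m, t.2 = word void w ++ nseq m None.

Definition repS (tp : tapes) (s : store) : Prop := forall i : 'I_k.+1, rep (tp i) (s i).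

Lemma rep_read t w : rep t w -> read t = if w is b :: _ then Some (inl b) else None.
Proof. by case: t w => l r [|b w] [_ [[|m] /= ->]]. Qed.

Lemma reads_at_rep tp s r : r <= k -> repS tp s ->
  reads_at (all_reads tp) r = if s r is b :: _ then Some (inl b) else None.
Proof. by move=> lerk H; rewrite /reads_at ffunE (rep_read (H _)) inordK. Qed.

(** Idle tapes rewrite the symbol they read. On an exhausted list this creates an explicit blank,
    which the padding in [rep] absorbs. *)
Lemma rep_write_read t w : rep t w -> rep (write_move t (read t, Stay)) w.
Proof.
case: t => l r [/= Hl [m ->]]; split=> //=; rewrite /read /=.
by case: w => [|b w] /=; [case: m => [|m]; [exists 1 | exists m.+1] | exists m].
Qed.

Lemma repS_perform tp s r a w : repS tp s ->
  (forall i : 'I_k.+1, i = r :> nat -> rep (tp i) (s r) -> rep (write_move (tp i) a) w) ->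
  repS (perform tp (Some (r, a))) (upd s r w).
Proof.
move=> H Ha i; rewrite /upd !ffunE; case: eqP => [e|_].
  by apply: Ha => //; rewrite -e.
exact: rep_write_read.
Qed.

Lemma repS_nop tp s : repS tp s -> repS (perform tp None) s.
Proof. by move=> H i; rewrite !ffunE; apply: rep_write_read. Qed.

Lemma compile_correct c s s' n tp : exec c s s' n -> max_reg c <= k -> repS tp s ->
  exists2 tp', reach (cstart c) tp n tp' & repS tp' s'.
Proof.
move=> H; elim: H tp => {c s s' n} /=.
- move=> s tp _ H; exists (perform tp None); last exact: repS_nop.
  by apply: ReachExit.
- move=> r b s tp lerk H.
  set tp1 := perform tp (Some (r, (reads_at (all_reads tp) r, MoveLeft))).
  exists (perform tp1 (Some (r, (Some (inl b), Stay)))).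
    apply: (@ReachStep (Push r b) _ _ false tp1) => //.
    by apply: ReachExit.
  move=> i; rewrite /upd; case: eqP => [eir|neir].
    have := H i; rewrite /tp1 !ffunE eir eqxx /reads_at.
    have -> : inord r = i :> 'I_k.+1 by apply: val_inj; rewrite /= inordK.
    rewrite ffunE /read; case: (tp i) => l w [/= Hl [m Hm]]; split=> /=.
      by case: l Hl => //= x l /andP[].
    rewrite {}Hm; case: (s r) => [|x v] /=; last by exists m.
    by case: m => [|m]; [exists 1 | exists m.+1].
  have F (u : {ffun 'I_k.+1 -> tape void}) a :
      rep (u i) (s i) -> rep (perform u (Some (r, a)) i) (s i).
    by move=> Hu; rewrite !ffunE; case: eqP => // _; apply: rep_write_read.
  by apply/F/F.
- move=> r s tp lerk H.
  exists (perform tp (Some (r, (None, MoveRight)))); first by apply: ReachExit.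
  apply: repS_perform => // i _; case: (tp i) => l w [/= Hl [m ->]].
  split=> //=; case: (s r) => [|x v] /=; last by exists m.
  by exists m.-1; case: m.
- move=> r c0 cf ct s s' n sr _ IH tp Hk H.
  have [tp' R S'] := IH (perform tp None) ltac:(lia) (repS_nop H).
  exists tp' => //.
  apply: (@ReachStep (Case r c0 cf ct) None tp (Some (inl (inl (cstart c0))))
    (perform tp None)).
    by rewrite /cnext /= (@reads_at_rep _ s) ?sr //; lia.
  apply: (@reach_sim c0 (Case r c0 cf ct) (fun z => Some (inl (inl z))) None) R.
  by move=> q rd /=; case: (ctrans q rd) => [[z|] act].
- move=> r c0 cf ct s s' n b w sr _ IH tp Hk H.
  have [tp' R S'] := IH (perform tp None) ltac:(case: (b); lia) (repS_nop H).
  exists tp' => //.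
  have rdr : reads_at (all_reads tp) r = Some (inl b).
    by rewrite (@reads_at_rep _ s) ?sr //; lia.
  case: b {sr IH} R rdr => R rdr.
    apply: (@ReachStep (Case r c0 cf ct) None tp (Some (inr (cstart ct)))
      (perform tp None)).
      by rewrite /cnext /= rdr.
    apply: (@reach_sim ct (Case r c0 cf ct) (fun z => Some (inr z)) None) R.
    by move=> q rd /=; case: (ctrans q rd) => [[z|] act].
  apply: (@ReachStep (Case r c0 cf ct) None tp (Some (inl (inr (cstart cf))))
    (perform tp None)).
    by rewrite /cnext /= rdr.
  apply: (@reach_sim cf (Case r c0 cf ct) (fun z => Some (inl (inr z))) None) R.
  by move=> q rd /=; case: (ctrans q rd) => [[z|] act].
- move=> c1 c2 s1 s2 s3 n1 n2 _ IH1 _ IH2 tp Hk H.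
  have [tp1 R1 H1] := IH1 tp ltac:(lia) H.
  have [tp2 R2 H2] := IH2 tp1 ltac:(lia) H1.
  exists tp2 => //.
  apply: (@reach_sim c1 (Seq c1 c2) inl (Some (inr (cstart c2))) _ _ _ _ _ R1).
    by move=> q rd /=; case: (ctrans q rd) => [[z|] act].
  apply: (@reach_sim c2 (Seq c1 c2) inr None) R2.
  by move=> q rd /=; case: (ctrans q rd) => [[z|] act].
- move=> r c s sr tp Hk H; exists (perform tp None); last exact: repS_nop.
  apply: ReachExit; rewrite /cnext /= (@reads_at_rep _ s) ?sr //; lia.
- move=> r c s1 s2 s3 n1 n2 sr _ IH1 _ IH2 tp Hk H.
  have [tp1 R1 H1] := IH1 (perform tp None) ltac:(lia) (repS_nop H).
  have [tp2 R2 H2] := IH2 tp1 ltac:(lia) H1.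
  exists tp2 => //.
  apply: (@ReachStep (While r c) None tp (Some (cstart c)) (perform tp None)).
    rewrite /cnext /= (@reads_at_rep _ s1) //; last by lia.
    by case: (s1 r) sr.
  apply: (@reach_sim c (While r c) Some (Some None) _ _ _ _ _ R1) => //.
  by move=> q rd /=; case: (ctrans q rd) => [[z|] act].
Qed.

End Compile.

(** The state [None], without transitions, is entered when control leaves the command; every other
    state has exactly one transition. *)
Definition machine_of (c : cmd) : machine :=
  @Machine (max_reg c) (option (cstate c)) void (Some (cstart c)) xpredT
    (fun q rd => if q is Some q then
       let (q', act) := ctrans q (reads_at rd) in [:: (q', actions rd act)]
     else [::]).

Lemma successors_machine_of c (q : cstate c) tp :
  successors ((Some q, tp) : config (machine_of c)) = [:: cnext q tp].
Proof. by rewrite /successors /cnext /=; case: (ctrans _ _). Qed.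

Lemma path_of_reach c (q : cstate c) tp n tp' : reach q tp n tp' ->
  exists s : seq (config (machine_of c)),
    [/\ path (@step (machine_of c)) (Some q, tp) s,
        last ((Some q, tp) : config (machine_of c)) s = (None, tp') & size s = n].
Proof.
elim=> {q tp n tp'} [q tp tp' E | q tp q1 tp1 n tp' E _ [s [H1 H2 H3]]].
  by exists [:: (None, tp')]; split=> //=; rewrite /step successors_machine_of E mem_head.
exists ((Some q1, tp1) :: s); split=> //=; last by rewrite H3.
by rewrite H1 andbT /step successors_machine_of E mem_head.
Qed.

Definition input_store (x : seq bool) : store := upd (fun _ => [::]) 0 x.

Lemma exec_polytime c (f : seq bool -> seq bool) (d : nat) :
  (forall x, exists s n, [/\ exec c (input_store x) s n, s 0 = f x
     & n <= (size x + 2) ^ d]) ->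
  polytime_computable f.
Proof.
move=> H; exists (machine_of c), (('X + 2%:P) ^+ d)%R; split.
  by move=> [q|] r //=; case: (ctrans _ _).
move=> x; have [s [n [Hex s0 Hn]]] := H x.
pose tp0 := (init (machine_of c) x).2.
have H0 : repS tp0 (input_store x).
  move=> i; rewrite /tp0 ffunE; split=> //=; exists 0; rewrite cats0 /input_store /upd.
  by rewrite -val_eqE /=; case: ifP.
have [tp' R Hs] := compile_correct Hex (leqnn _) H0.
have [cs [P1 P2 P3]] := path_of_reach R.
exists cs; have E : last (init (machine_of c) x) cs = (None, tp') by rewrite -P2.
split=> //; first by rewrite /halted E.
  by rewrite P3 (leq_trans Hn) // horner_exp hornerD hornerX hornerC.
by rewrite E; have [_] := Hs ord0; rewrite s0.
Qed.

(** * Upper bounds on running times, and basic stack routines *)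

Definition runs c s s' n := exists2 m, exec c s s' m & m <= n.

Lemma runsW c s s' n s'' n' : runs c s s' n -> s' = s'' -> n <= n' -> runs c s s'' n'.
Proof. by move=> [m H1 H2] <- H3; exists m => //; lia. Qed.

Lemma runs_seq c1 c2 s1 s2 s3 n1 n2 :
  runs c1 s1 s2 n1 -> runs c2 s2 s3 n2 -> runs (c1 ;; c2) s1 s3 (n1 + n2).
Proof. by move=> [m1 H1 L1] [m2 H2 L2]; exists (m1 + m2); [exact: ExSeq H1 H2 | lia]. Qed.

Lemma runs_skip s : runs Skip s s 1.
Proof. by exists 1 => //; constructor. Qed.

Lemma runs_push r b s : runs (Push r b) s (upd s r (b :: s r)) 2.
Proof. by exists 2 => //; constructor. Qed.

Lemma runs_pop r s : runs (Pop r) s (upd s r (behead (s r))) 1.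
Proof. by exists 1 => //; constructor. Qed.

Lemma runs_case r c0 cf ct s s' n :
  runs (if s r is b :: _ then if b then ct else cf else c0) s s' n ->
  runs (Case r c0 cf ct) s s' n.+1.
Proof.
case E: (s r) => [|b w] [m H L]; exists m.+1 => //; first exact: ExCaseNil H.
exact: ExCaseCons E H.
Qed.

(** [f i] is the store before iteration [i]. Charging the same [B] to every iteration is possible
    because [runs] keeps only an upper bound. *)
Lemma runs_while r c (f : nat -> store) n B :
  (forall i, i < n -> f i r <> [::] /\ runs c (f i) (f i.+1) B) -> f n r = [::] ->
  runs (While r c) (f 0) (f n) (n * B.+1).+1.
Proof.
elim: n f => [|n IH] f Hf fn; first by exists 1 => //; exact: ExWhileNil.
have [||m Hm Lm] := IH (fun i => f i.+1); [by move=> i ?; apply: Hf | by [] |].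
have [f0 [m0 H0 L0]] := Hf 0 isT.
by exists (m0 + m).+1; [exact: ExWhileCons H0 Hm | lia].
Qed.

Ltac regs := rewrite /upd /=; repeat (case: eqP => ?; try lia).
Ltac store_eq :=
  let z := fresh "z" in
  apply: functional_extensionality => z; rewrite /upd;
  repeat (case: eqP => ?; try lia);
  try match goal with e : z = _ |- _ => subst z end; rewrite //=.

Notation ones n := (nseq n true).

Lemma ones_sub n i : i < n -> ones (n - i) = true :: ones (n - i.+1).
Proof. by move=> lt_i_n; have -> : n - i = (n - i.+1).+1 by lia. Qed.

Lemma ones_add m n : ones m ++ ones n = ones (m + n).
Proof. by rewrite nseqD. Qed.

Definition clear r := While r (Pop r).

Lemma runs_clear r s : runs (clear r) s (upd s r [::]) ((size (s r)).*2.+1).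
Proof.
pose f i := upd s r (drop i (s r)).
have := @runs_while r (Pop r) f (size (s r)) 1.
have -> : f 0 = s by rewrite /f drop0; store_eq.
have -> : f (size (s r)) = upd s r [::] by rewrite /f drop_size.
move=> H; apply: runsW (H _ _) _ _ => //; [|by regs|lia].
move=> i lti; rewrite /f; split; first by regs; rewrite (drop_nth true).
apply: runsW (runs_pop _ _) _ _ => //; store_eq.
by rewrite -drop1 drop_drop addnC addn1.
Qed.

Definition addto r a := While r (Pop r ;; Push a true).

Lemma runs_addto r a s n : r <> a -> s r = ones n ->
  runs (addto r a) s (upd (upd s r [::]) a (ones n ++ s a)) (n * 4).+1.
Proof.
move=> ra sr; pose f i := upd (upd s r (ones (n - i))) a (ones i ++ s a).
have := @runs_while r (Pop r ;; Push a true) f n 3.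
have -> : f 0 = s by rewrite /f subn0 -sr; store_eq.
have -> : f n = upd (upd s r [::]) a (ones n ++ s a) by rewrite /f subnn.
move=> H; apply: H; last by regs.
move=> i lti; rewrite /f (ones_sub lti); split; first by regs.
by apply: runsW (runs_seq (runs_pop _ _) (runs_push _ _ _)) _ _ => //; store_eq.
Qed.

Definition addto2 r a b := While r (Pop r ;; Push a true ;; Push b true).

Lemma runs_addto2 r a b s n : r <> a -> r <> b -> a <> b -> s r = ones n ->
  runs (addto2 r a b) s
    (upd (upd (upd s r [::]) a (ones n ++ s a)) b (ones n ++ s b)) (n * 6).+1.
Proof.
move=> ra rb ab sr.
pose f i := upd (upd (upd s r (ones (n - i))) a (ones i ++ s a)) b (ones i ++ s b).
have := @runs_while r (Pop r ;; Push a true ;; Push b true) f n 5.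
have -> : f 0 = s by rewrite /f subn0 -sr; store_eq.
have -> : f n = upd (upd (upd s r [::]) a (ones n ++ s a)) b (ones n ++ s b).
  by rewrite /f subnn.
move=> H; apply: H; last by regs.
move=> i lti; rewrite /f (ones_sub lti); split; first by regs.
apply: runsW (runs_seq (runs_pop _ _) (runs_seq (runs_push _ _ _) (runs_push _ _ _))) _ _ => //.
by store_eq.
Qed.

Definition mvbit r a := Case r Skip (Pop r ;; Push a false) (Pop r ;; Push a true).

Lemma runs_mvbit r a s : r <> a ->
  runs (mvbit r a) s
    (upd (upd s r (behead (s r))) a (if s r is b :: _ then b :: s a else s a)) 4.
Proof.
move=> ra; apply: runs_case; case E: (s r) => [|b w].
  by apply: runsW (runs_skip _) _ _ => //; store_eq.
case: b E => E; apply: runsW (runs_seq (runs_pop _ _) (runs_push _ _ _)) _ _ => //;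
  by store_eq; rewrite ?E.
Qed.

Definition mvbits r a := While r (mvbit r a).

Lemma runs_mvbits r a s : r <> a ->
  runs (mvbits r a) s (upd (upd s r [::]) a (catrev (s r) (s a))) (size (s r) * 5).+1.
Proof.
move=> ra; pose f i := upd (upd s r (drop i (s r))) a (catrev (take i (s r)) (s a)).
have := @runs_while r (mvbit r a) f (size (s r)) 4.
have -> : f 0 = s by rewrite /f drop0 take0; store_eq.
have -> : f (size (s r)) = upd (upd s r [::]) a (catrev (s r) (s a)).
  by rewrite /f drop_size take_size.
move=> H; apply: H; last by regs.
move=> i lti; rewrite /f; split; first by regs; rewrite (drop_nth true).
apply: runsW (runs_mvbit _ ra) _ _ => //; store_eq.
- by rewrite (take_nth true) // -cats1 !catrevE rev_cat (drop_nth true).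
- by rewrite (drop_nth true).
Qed.

(** * Arithmetic expressions in unary *)

(* [EU] and [EV] are the two variables; the divisor of [EDiv a b] is [b.+1]. *)
Inductive expr :=
| EU | EV | ELen
| EConst of nat
| EInp of expr
| EAdd of expr & expr
| ESub of expr & expr
| EMul of expr & expr
| EDiv of expr & expr.

Definition inp_code (x : seq bool) i : nat :=
  if drop i x is b :: _ then if b then 2 else 1 else 0.

Fixpoint eval (x : seq bool) (u v : nat) (e : expr) : nat :=
  match e with
  | EU => u
  | EV => v
  | ELen => size x
  | EConst n => n
  | EInp a => inp_code x (eval x u v a)
  | EAdd a b => eval x u v a + eval x u v b
  | ESub a b => eval x u v a - eval x u v b
  | EMul a b => eval x u v a * eval x u v b
  | EDiv a b => eval x u v a %/ (eval x u v b).+1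
  end.

(** Moving a unary number destroys it, so it is moved to two registers at once and one of the copies
    is moved back. *)
Definition copy r d := addto2 r d d.+1 ;; addto d.+1 r.

(** The value is left in the register [d], those above being scratch. [ELen] and [EInp] pour the
    input onto another stack and back; [EDiv] counts the divisor down in [d.+2] while [d.+3]
    collects what was counted. *)
Fixpoint comp (d : nat) (e : expr) : cmd :=
  match e with
  | EU => copy 2 d
  | EV => copy 3 d
  | ELen => While 0 (Push d true ;; mvbit 0 d.+1) ;; mvbits d.+1 0
  | EConst n => iter n (Seq (Push d true)) Skip
  | EInp a => comp d.+1 a ;; While d.+1 (Pop d.+1 ;; mvbit 0 d.+2) ;;
      Case 0 Skip (Push d true) (Push d true ;; Push d true) ;; mvbits d.+2 0
  | EAdd a b => comp d a ;; comp d.+1 b ;; addto d.+1 d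
  | ESub a b => comp d a ;; comp d.+1 b ;; While d.+1 (Pop d.+1 ;; Pop d)
  | EMul a b => comp d.+1 a ;; comp d.+2 b ;;
      While d.+1 (Pop d.+1 ;; addto2 d.+2 d d.+3 ;; addto d.+3 d.+2) ;; clear d.+2
  | EDiv a b => comp d.+1 a ;; comp d.+2 b ;; Push d.+2 true ;;
      While d.+1 (Pop d.+1 ;; Pop d.+2 ;; Push d.+3 true ;;
                  Case d.+2 (Push d true ;; addto d.+3 d.+2) Skip Skip) ;;
      clear d.+2 ;; clear d.+3
  end.

Definition ready (d : nat) (x : seq bool) (u v : nat) (s : store) : Prop :=
  [/\ 4 <= d, s 0 = x, s 2 = ones u, s 3 = ones v & forall z, d <= z -> s z = [::]].

Lemma ready_upd d d' x u v s w : ready d x u v s -> d <= d' ->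
  ready d'.+1 x u v (upd s d' w).
Proof.
move=> [d4 H0 H2 H3 Hd] dd'; split; try by regs. by lia.
by move=> z dz; regs; apply: Hd; lia.
Qed.

Lemma readyS d x u v s : ready d x u v s -> ready d.+1 x u v s.
Proof. by move=> [d4 H0 H2 H3 Hd]; split=> //; [lia|move=> z dz; apply: Hd; lia]. Qed.

Lemma ready_nil d x u v s z : ready d x u v s -> d <= z -> s z = [::].
Proof. by move=> [_ _ _ _ H] /H. Qed.

(** The base [B + 2] is at least 2, so the constant 128 costs 7 in the exponent, and squaring
    doubles it. *)
Lemma poly_bound B a b c : a <= (B + 2) ^ c -> b <= 128 * a ^ 2 ->
  b <= (B + 2) ^ (7 + c + c).
Proof.
move=> Ha Hb; apply: leq_trans Hb _.
rewrite -addnA expnD leq_mul //; first by rewrite (@leq_exp2r 2 _ 7) //; lia.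
by rewrite addnn -muln2 expnM leq_exp2r.
Qed.

Lemma leq_pow2 B c c' : c <= c' -> (B + 2) ^ c <= (B + 2) ^ c'.
Proof. by move=> ?; rewrite leq_pexp2l //; lia. Qed.

Lemma runs_copy r d x u v s n : ready d x u v s -> r < d -> s r = ones n ->
  runs (copy r d) s (upd s d (ones n)) (n * 10 + 2).
Proof.
move=> Hs rd sr.
have sd := ready_nil Hs (leqnn d); have sd1 := ready_nil Hs (leqnSn d).
apply: runsW (runs_seq (runs_addto2 _ _ _ sr) (@runs_addto _ _ _ n _ _)) _ _; try lia.
  by regs; rewrite sd1 cats0.
by store_eq; rewrite ?sd ?cats0.
Qed.

(** Each operation loops over values bounded by a power of [B + 2], at a cost at most quadratic in
    that power up to a constant; the exponent depends on the expression alone. *)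
Lemma comp_correct e : exists c, forall x u v B, size x <= B -> u <= B -> v <= B ->
  eval x u v e <= (B + 2) ^ c /\
  forall d s, ready d x u v s ->
    runs (comp d e) s (upd s d (ones (eval x u v e))) ((B + 2) ^ c).
Proof.
elim: e => [|||n|a [ca IHa]|a [ca IHa] b [cb IHb]|a [ca IHa] b [cb IHb]
  |a [ca IHa] b [cb IHb]|a [ca IHa] b [cb IHb]] /=.
- exists (7 + 1 + 1) => x u v B Hx Hu Hv; split.
    by apply: (@poly_bound _ (B + 2)) => //; nia.
  move=> d s Hs; have [d4 _ s2 _ _] := Hs.
  apply: runsW (runs_copy Hs _ s2) _ _ => //; first by lia.
  by apply: (@poly_bound _ (B + 2)) => //; nia.
- exists (7 + 1 + 1) => x u v B Hx Hu Hv; split.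
    by apply: (@poly_bound _ (B + 2)) => //; nia.
  move=> d s Hs; have [d4 _ _ s3 _] := Hs.
  apply: runsW (runs_copy Hs _ s3) _ _ => //.
  by apply: (@poly_bound _ (B + 2)) => //; nia.
- exists (7 + 1 + 1) => x u v B Hx Hu Hv; split.
    by apply: (@poly_bound _ (B + 2)) => //; nia.
  move=> d s Hs; have [d4 s0 _ _ _] := Hs.
  have sd := ready_nil Hs (leqnn d); have sd1 := ready_nil Hs (leqnSn d).
  pose f i := upd (upd (upd s d (ones i)) 0 (drop i x)) d.+1 (rev (take i x)).
  have := @runs_while 0 (Push d true ;; mvbit 0 d.+1) f (size x) 6.
  have -> : f 0 = s by rewrite /f drop0 take0; store_eq.
  move=> Hw; apply: runsW (runs_seq (Hw _ _) (@runs_mvbits d.+1 0 _ _)) _ _; try lia.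
  + move=> i lti; rewrite /f; split; first by regs; rewrite (drop_nth true).
    apply: runsW (runs_seq (runs_push _ _ _) (@runs_mvbit 0 d.+1 _ _)) _ _; try lia.
    store_eq; last by rewrite (drop_nth true).
    by rewrite (drop_nth true) //= (take_nth true) // rev_rcons.
  + by rewrite /f; regs; rewrite drop_size.
  + rewrite /f; store_eq; rewrite take_size drop_size.
    by rewrite -[catrev _ _]/(rev (rev x)) revK.
  + rewrite /f /upd eqxx take_size size_rev.
    by apply: (@poly_bound _ (B + 2)) => //; nia.
- exists (n + 1).*2 => x u v B Hx Hu Hv.
  have L : n * 2 + 1 <= (B + 2) ^ (n + 1).*2.
    have H1 : 2 ^ (n + 1).*2 <= (B + 2) ^ (n + 1).*2 by rewrite leq_exp2r; lia.
    by have := @ltn_expl 2 (n + 1).*2 isT; lia.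
  split=> [|d s Hs]; first by lia.
  have sd := ready_nil Hs (leqnn d).
  apply: runsW (_ : runs _ _ _ (n * 2 + 1)) erefl L.
  have -> : ones n = ones n ++ s d by rewrite sd cats0.
  elim: n s {sd Hs} => [|n IH] s /=.
    by apply: runsW (runs_skip _) _ _ => //; store_eq.
  apply: runsW (runs_seq (runs_push _ _ _) (IH _)) _ _; last by lia.
  by store_eq; rewrite -cat_rcons -cats1 (ones_add n 1) addn1.
- exists (7 + (ca + 2) + (ca + 2)) => x u v B Hx Hu Hv.
  have [La Ra] := IHa x u v B Hx Hu Hv.
  set Z := (B + 2) ^ ca in La Ra.
  have EZ : (B + 2) ^ (ca + 2) = Z * (B + 2) ^ 2 by rewrite expnD.
  have Z1 : 0 < Z by rewrite expn_gt0; lia.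
  split; first by apply: (@poly_bound _ 1); [rewrite EZ; nia|rewrite /inp_code;
    case: (drop _ _) => [|[]]].
  move=> d s Hs; have [d4 s0 _ _ _] := Hs.
  have sd := ready_nil Hs (leqnn d); have sd1 := ready_nil Hs (leqnSn d).
  have sd2 : s d.+2 = [::] by apply: (ready_nil Hs); lia.
  set n := eval x u v a in La Ra *.
  pose f i := upd (upd (upd s d.+1 (ones (n - i))) 0 (drop i x)) d.+2 (rev (take i x)).
  have := @runs_while d.+1 (Pop d.+1 ;; mvbit 0 d.+2) f n 5.
  have -> : f 0 = upd s d.+1 (ones n) by rewrite /f drop0 take0 subn0; store_eq.
  move=> Hw; apply: runsW (runs_seq (Ra _ _ (readyS Hs)) (runs_seq (Hw _ _)
    (runs_seq (@runs_case _ _ _ _ _ (upd (f n) d (ones (inp_code x n))) 4 _)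
       (@runs_mvbits d.+2 0 _ _)))) _ _; try lia.
  + move=> i lti; rewrite /f (ones_sub lti); split; first by regs.
    apply: runsW (runs_seq (runs_pop _ _) (@runs_mvbit 0 d.+2 _ _)) _ _; try lia.
    store_eq.
    (* Beyond the end of the input [mvbit] does nothing, and [take] and [drop] have become
       stationary. *)
    * case: (ltnP i (size x)) => lix.
        by rewrite (drop_nth true) //= (take_nth true) // rev_rcons.
      by rewrite drop_oversize //= !take_oversize //; lia.
    * by rewrite -drop1 drop_drop add1n.
  + by rewrite /f; regs; rewrite subnn.
  + rewrite /inp_code {1}/f; regs; case: (drop n x) => [|[] w].
    * by apply: runsW (runs_skip _) _ _ => //; rewrite /f; store_eq.
    * apply: runsW (runs_seq (runs_push _ _ _) (runs_push _ _ _)) _ _ => //.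
      by rewrite /f; store_eq; rewrite sd.
    * apply: runsW (runs_push _ _ _) _ _ => //.
      by rewrite /f; store_eq; rewrite sd.
  + rewrite /f; store_eq.
      by rewrite catrevE revK cat_take_drop.
    by rewrite subnn sd1.
  + set w := size _.
    have Hw' : w <= B by rewrite /w /f; regs; rewrite size_rev size_take; case: ifP; lia.
    apply: (@poly_bound _ (Z * (B + 2) ^ 2)); rewrite ?EZ //.
    have YZ : Z <= Z * (B + 2) ^ 2 by nia.
    have YB : B <= Z * (B + 2) ^ 2 by nia.
    by move: YZ YB; set Y := Z * _ => YZ YB; nia.
- exists (7 + (ca + cb) + (ca + cb)) => x u v B Hx Hu Hv.
  have [La Ra] := IHa x u v B Hx Hu Hv; have [Lb Rb] := IHb x u v B Hx Hu Hv.
  have := leq_pow2 B (leq_addr cb ca); have := leq_pow2 B (leq_addl ca cb).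
  set Z := (B + 2) ^ (ca + cb) => cbZ caZ.
  have Z1 : 0 < Z by rewrite expn_gt0; lia.
  split; first by apply: (@poly_bound _ Z) => //; nia.
  move=> d s Hs; have [d4 s0 _ _ _] := Hs.
  have sd := ready_nil Hs (leqnn d); have sd1 := ready_nil Hs (leqnSn d).
  apply: runsW (runs_seq (Ra _ _ Hs) (runs_seq (Rb _ _ (ready_upd (ones (eval x u v a)) Hs (leqnn d)))
    (@runs_addto _ _ _ (eval x u v b) _ _))) _ _; try lia.
  + by regs.
  + by store_eq; rewrite ones_add addnC.
  + by apply: (@poly_bound _ Z) => //; nia.
- exists (7 + (ca + cb) + (ca + cb)) => x u v B Hx Hu Hv.
  have [La Ra] := IHa x u v B Hx Hu Hv; have [Lb Rb] := IHb x u v B Hx Hu Hv.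
  have := leq_pow2 B (leq_addr cb ca); have := leq_pow2 B (leq_addl ca cb).
  set Z := (B + 2) ^ (ca + cb) => cbZ caZ.
  have Z1 : 0 < Z by rewrite expn_gt0; lia.
  split; first by apply: (@poly_bound _ Z) => //; nia.
  move=> d s Hs; have [d4 s0 _ _ _] := Hs.
  have sd := ready_nil Hs (leqnn d); have sd1 := ready_nil Hs (leqnSn d).
  set m := eval x u v a in La Ra *; set n := eval x u v b in Lb Rb *.
  pose f i := upd (upd s d (ones (m - i))) d.+1 (ones (n - i)).
  have := @runs_while d.+1 (Pop d.+1 ;; Pop d) f n 2.
  have -> : f 0 = upd (upd s d (ones m)) d.+1 (ones n) by rewrite /f !subn0.
  move=> Hw; apply: runsW (runs_seq (Ra _ _ Hs)
    (runs_seq (Rb _ _ (ready_upd (ones (eval x u v a)) Hs (leqnn d))) (Hw _ _))) _ _.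
  + move=> i lti; rewrite /f (ones_sub lti); split; first by regs.
    apply: runsW (runs_seq (runs_pop _ _) (runs_pop _ _)) _ _ => //; store_eq.
    by rewrite subnS; case: (m - i).
  + by rewrite /f; regs; rewrite subnn.
  + by rewrite /f; store_eq; rewrite subnn.
  + by apply: (@poly_bound _ Z) => //; nia.
- exists (7 + (ca + cb) + (ca + cb)) => x u v B Hx Hu Hv.
  have [La Ra] := IHa x u v B Hx Hu Hv; have [Lb Rb] := IHb x u v B Hx Hu Hv.
  have := leq_pow2 B (leq_addr cb ca); have := leq_pow2 B (leq_addl ca cb).
  set Z := (B + 2) ^ (ca + cb) => cbZ caZ.
  have Z1 : 0 < Z by rewrite expn_gt0; lia.
  split; first by apply: (@poly_bound _ Z) => //; nia.
  move=> d s Hs; have [d4 s0 _ _ _] := Hs.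
  have sd := ready_nil Hs (leqnn d); have sd1 := ready_nil Hs (leqnSn d).
  have sd2 : s d.+2 = [::] by apply: (ready_nil Hs); lia.
  have sd3 : s d.+3 = [::] by apply: (ready_nil Hs); lia.
  set m := eval x u v a in La Ra *; set n := eval x u v b in Lb Rb *.
  pose f i := upd (upd (upd s d (ones (i * n))) d.+1 (ones (m - i))) d.+2 (ones n).
  have := @runs_while d.+1 (Pop d.+1 ;; addto2 d.+2 d d.+3 ;; addto d.+3 d.+2) f m (n * 10 + 3).
  have -> : f 0 = upd (upd s d.+1 (ones m)) d.+2 (ones n).
    by rewrite /f subn0 mul0n; store_eq.
  move=> Hw; apply: runsW (runs_seq (Ra _ _ (readyS Hs))
    (runs_seq (Rb _ _ (ready_upd (ones (eval x u v a)) Hs (leqnSn d)))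
    (runs_seq (Hw _ _) (runs_clear _ _)))) _ _.
  + move=> i lti; rewrite /f (ones_sub lti); split; first by regs.
    apply: runsW (runs_seq (runs_pop _ _) (runs_seq (@runs_addto2 _ _ _ _ n _ _ _ _)
       (@runs_addto _ _ _ n _ _))) _ _; try lia; try by regs; rewrite ?sd3 ?cats0.
    by store_eq; rewrite ?ones_add ?cats0 ?mulSn.
  + by rewrite /f; regs; rewrite subnn.
  + by rewrite /f; store_eq; rewrite subnn.
  + have -> : size (f m d.+2) = n by rewrite /f; regs; rewrite size_nseq.
    by apply: (@poly_bound _ Z) => //; nia.
- exists (7 + (ca + cb) + (ca + cb)) => x u v B Hx Hu Hv.
  have [La Ra] := IHa x u v B Hx Hu Hv; have [Lb Rb] := IHb x u v B Hx Hu Hv.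
  have := leq_pow2 B (leq_addr cb ca); have := leq_pow2 B (leq_addl ca cb).
  set Z := (B + 2) ^ (ca + cb) => cbZ caZ.
  have Z1 : 0 < Z by rewrite expn_gt0; lia.
  split.
    apply: (@poly_bound _ Z) => //; apply: leq_trans (leq_div _ _) _.
    by apply: leq_trans La _; nia.
  move=> d s Hs; have [d4 s0 _ _ _] := Hs.
  have sd := ready_nil Hs (leqnn d); have sd1 := ready_nil Hs (leqnSn d).
  have sd2 : s d.+2 = [::] by apply: (ready_nil Hs); lia.
  have sd3 : s d.+3 = [::] by apply: (ready_nil Hs); lia.
  set m := eval x u v a in La Ra *; set n := eval x u v b in Lb Rb *.
  (* After [i] decrements the registers hold the quotient so far, the rest of the dividend, what is
     missing from the current group of [n.+1], and what this group already contains. *)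
  pose f i := upd (upd (upd (upd s d (ones (i %/ n.+1))) d.+1 (ones (m - i)))
    d.+2 (ones (n.+1 - i %% n.+1))) d.+3 (ones (i %% n.+1)).
  have := @runs_while d.+1 (Pop d.+1 ;; Pop d.+2 ;; Push d.+3 true ;;
    Case d.+2 (Push d true ;; addto d.+3 d.+2) Skip Skip) f m (n * 4 + 13).
  have -> : f 0 = upd (upd (upd s d.+1 (ones m)) d.+2 (ones n)) d.+2 (ones n.+1).
    by rewrite /f subn0 div0n mod0n; store_eq.
  have -> : upd (upd (upd s d.+1 (ones m)) d.+2 (ones n)) d.+2 (ones n.+1) =
    upd (upd (upd s d.+1 (ones m)) d.+2 (ones n)) d.+2
     (true :: upd (upd s d.+1 (ones m)) d.+2 (ones n) d.+2) by store_eq.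
  move=> Hw; apply: runsW (runs_seq (Ra _ _ (readyS Hs))
    (runs_seq (Rb _ _ (ready_upd (ones (eval x u v a)) Hs (leqnSn d)))
    (runs_seq (runs_push _ _ _)
    (runs_seq (Hw _ _) (runs_seq (runs_clear _ _) (runs_clear _ _)))))) _ _.
  + move=> i lti; rewrite {1 2}/f (ones_sub lti); split; first by regs.
    have lt_r : i %% n.+1 < n.+1 by rewrite ltn_mod.
    have Ei := divn_eq i n.+1.
    apply: runsW (runs_seq (runs_pop _ _) (runs_seq (runs_pop _ _)
      (runs_seq (runs_push _ _ _) (@runs_case _ _ _ _ _ (f i.+1) (n * 4 + 8) _)))) _ _ => //;
      try lia.
    have := ltn_mod i n.+1; rewrite ltn0Sn.
    set q := i %/ n.+1 in Ei *; set r := i %% n.+1 in lt_r Ei *.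
    (* Either the group stays incomplete, or [r = n] and it is completed: the quotient grows and
       [d.+3] refills [d.+2]. *)
    case: (ltnP r n) => rn _.
      have [Eq Er] : i.+1 %/ n.+1 = q /\ i.+1 %% n.+1 = r.+1.
        have -> : i.+1 = q * n.+1 + r.+1 by lia.
        by rewrite divnMDl // modnMDl divn_small ?modn_small ?addn0 //; lia.
      rewrite (_ : n.+1 - r = (n - r.+1).+2); last by lia.
      regs; apply: runsW (runs_skip _) _ _; last by lia.
      rewrite /f Eq Er; store_eq.
      by rewrite ?subSS (_ : n - r = (n - r.+1).+1) //; lia.
    have rn' : r = n by lia.
    have [Eq Er] : i.+1 %/ n.+1 = q.+1 /\ i.+1 %% n.+1 = 0.
      have -> : i.+1 = q.+1 * n.+1 + 0 by lia.
      by rewrite divnMDl // modnMDl divn_small ?modn_small ?addn0 //; lia.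
    rewrite (_ : n.+1 - r = 1); last by lia.
    rewrite rn'; regs.
    apply: runsW (runs_seq (runs_push _ _ _) (@runs_addto _ _ _ n.+1 _ _)) _ _; try lia.
      by regs.
    by rewrite /f Eq Er; store_eq; rewrite cats0.
  + by rewrite /f; regs; rewrite subnn.
  + by rewrite /f; store_eq; rewrite subnn.
  + apply: (@poly_bound _ Z) => //.
    have : size (f m d.+2) <= n.+1 by rewrite /f; regs; rewrite size_nseq; lia.
    have : size (upd (f m) d.+2 [::] d.+3) <= n.+1.
      by rewrite /f; regs; rewrite size_nseq ltnW // ltn_mod.
    nia.
Qed.

Lemma comp_correct_seq es : exists c, forall x u v B, size x <= B -> u <= B -> v <= B ->
  forall e, List.In e es ->
  eval x u v e <= (B + 2) ^ c /\
  forall d s, ready d x u v s ->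
    runs (comp d e) s (upd s d (ones (eval x u v e))) ((B + 2) ^ c).
Proof.
elim: es => [|e es [c IH]]; first by exists 0.
have [c' H'] := comp_correct e; exists (c + c') => x u v B Hx Hu Hv e' He'.
have L1 := leq_pow2 B (leq_addr c' c); have L2 := leq_pow2 B (leq_addl c c').
case: He' => [<-|/(IH x u v B Hx Hu Hv)] {IH}.
  have [H1 H2] := H' x u v B Hx Hu Hv; split; first exact: leq_trans H1 L2.
  by move=> d s /H2 R; apply: runsW R _ _.
move=> [H1 H2]; split; first exact: leq_trans H1 L1.
by move=> d s /H2 R; apply: runsW R _ _.
Qed.

(** * Printing adjacency matrices described by expressions *)

Definition emit_row e :=
  copy 4 6 ;;
  While 6 (Pop 6 ;; comp 7 e ;; Case 7 (Push 1 false) (Push 1 true) (Push 1 true) ;;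
           clear 7 ;; Push 3 true) ;;
  clear 3.

Definition emit_matrix e :=
  copy 4 5 ;; While 5 (Pop 5 ;; emit_row e ;; Push 2 true) ;; clear 2.

Definition emit_bits (bs : seq bool) := foldr (fun b c => Push 1 b ;; c) Skip bs.

(** The output is pushed on register 1, hence built in reverse; the final [mvbits] turns it around
    onto the cleared register 0. Register 4 keeps the size, 5 and 6 count the remaining rows and
    columns, 2 and 3 hold the current indices. *)
Definition emit_all en es hdr :=
  comp 4 en ;; copy 4 5 ;; addto 5 1 ;; emit_bits (false :: hdr) ;;
  foldr (fun e c => emit_matrix e ;; c) Skip es ;; clear 0 ;; mvbits 1 0.

Definition layout x out u v n cu cv : store := fun z =>
  match z with
  | 0 => x | 1 => out | 2 => ones u | 3 => ones v | 4 => ones n | 5 => ones cu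
  | 6 => ones cv | _ => [::]
  end.

Ltac layout_eq := by apply: functional_extensionality => -[|[|[|[|[|[|[|[|?]]]]]]]].

Definition row x n u e := [seq eval x u v e != 0 | v <- iota 0 n].
Definition matrix x n e := [seq eval x u v e != 0 | u <- iota 0 n, v <- iota 0 n].

Lemma catrev_cat (T : Type) (a b c : seq T) : catrev (a ++ b) c = catrev b (catrev a c).
Proof. by elim: a c => //=. Qed.

Section Emit.
Variables (x : seq bool) (n Z : nat) (es : seq expr).
Hypothesis n_leZ : n <= Z.
Hypothesis Z_gt0 : 0 < Z.
Hypothesis compP : forall u v e, u <= n -> v <= n -> List.In e es ->
  eval x u v e <= Z /\
  forall d s, ready d x u v s -> runs (comp d e) s (upd s d (ones (eval x u v e))) Z.

Lemma runs_emit_test m s : s 7 = ones m ->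
  runs (Case 7 (Push 1 false) (Push 1 true) (Push 1 true)) s
    (upd s 1 ((m != 0) :: s 1)) 3.
Proof. by move=> s7; apply: runs_case; rewrite s7; case: m {s7} => [|m]; apply: runs_push. Qed.

Lemma runs_emit_row e out u cu : List.In e es -> u <= n ->
  runs (emit_row e) (layout x out u 0 n cu 0)
    (layout x (catrev (row x n u e) out) u 0 n cu 0) (40 * Z ^ 2).
Proof.
move=> ees un.
pose f i := layout x (catrev (row x i u e) out) u i n cu (n - i).
have E0 : upd (layout x out u 0 n cu 0) 6 (ones n) = f 0.
  by rewrite /f subn0 /row /=; layout_eq.
have R6 : ready 6 x u 0 (layout x out u 0 n cu 0) by split=> // -[|[|[|[|[|[|[|z]]]]]]].
apply: runsW (runs_seq (runsW (@runs_copy 4 6 _ _ _ _ n R6 isT erefl) E0 (leqnn _))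
  (runs_seq (@runs_while 6 _ f n (3 * Z + 8) _ _) (runs_clear _ _))) _ _ => //.
- move=> i lti; rewrite /f (_ : n - i = (n - i.+1).+1); last by lia.
  split=> //.
  have [Le Re] := compP un (ltnW lti) ees.
  apply: runsW (runs_seq (runs_pop _ _) (runs_seq (Re _ _ _)
    (runs_seq (@runs_emit_test (eval x u i e) _ _)
    (runs_seq (runs_clear _ _) (runs_push _ _ _))))) _ _.
  + by split=> // -[|[|[|[|[|[|[|z]]]]]]].
  + by [].
  + have -> : row x i.+1 u e = row x i u e ++ [:: eval x u i e != 0].
      by rewrite /row -addn1 iotaD map_cat.
    by rewrite catrev_cat; layout_eq.
  + by rewrite /upd /= size_nseq; lia.
- by rewrite /f subnn.
- by rewrite /f subnn; layout_eq.
- by rewrite /= size_nseq; nia.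
Qed.

Lemma runs_emit_matrix e out : List.In e es ->
  runs (emit_matrix e) (layout x out 0 0 n 0 0)
    (layout x (catrev (matrix x n e) out) 0 0 n 0 0) (60 * Z ^ 3).
Proof.
move=> ees.
pose g i := flatten [seq row x n u e | u <- iota 0 i].
pose f i := layout x (catrev (g i) out) i 0 n (n - i) 0.
have E0 : upd (layout x out 0 0 n 0 0) 5 (ones n) = f 0.
  by rewrite /f subn0 /g /=; layout_eq.
have R5 : ready 5 x 0 0 (layout x out 0 0 n 0 0) by split=> // -[|[|[|[|[|[|[|z]]]]]]].
apply: runsW (runs_seq (runsW (@runs_copy 4 5 _ _ _ _ n R5 isT erefl) E0 (leqnn _))
  (runs_seq (@runs_while 5 _ f n (40 * Z ^ 2 + 3) _ _) (runs_clear _ _))) _ _ => //.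
- move=> i lti; rewrite /f (_ : n - i = (n - i.+1).+1); last by lia.
  split=> //.
  apply: runsW (runs_seq
    (runsW (runs_pop _ _) (_ : _ = layout x (catrev (g i) out) i 0 n (n - i.+1) 0) (leqnn _))
    (runs_seq (runs_emit_row _ _ ees (ltnW lti))
    (runs_push _ _ _))) _ _; try lia.
    by layout_eq.
  have -> : g i.+1 = g i ++ row x n i e.
    by rewrite /g -addn1 iotaD map_cat flatten_cat /= cats0.
  by rewrite catrev_cat; layout_eq.
- by rewrite /f subnn.
- rewrite /f subnn. layout_eq.
- by rewrite /= size_nseq; nia.
Qed.

Lemma runs_emit_matrices es' out : (forall e, List.In e es' -> List.In e es) ->
  runs (foldr (fun e c => emit_matrix e ;; c) Skip es') (layout x out 0 0 n 0 0)
    (layout x (catrev (flatten [seq matrix x n e | e <- es']) out) 0 0 n 0 0)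
    (size es' * (60 * Z ^ 3)).+1.
Proof.
elim: es' out => [|e es' IH] out Hes /=; first exact: runs_skip.
apply: runsW (runs_seq (runs_emit_matrix _ (Hes _ _)) (IH _ _)) _ _.
- by left.
- by move=> e' ?; apply: Hes; right.
- by rewrite catrev_cat.
- by lia.
Qed.

End Emit.

Lemma runs_emit_bits bs s :
  runs (emit_bits bs) s (upd s 1 (catrev bs (s 1))) (size bs * 2 + 1).
Proof.
elim: bs s => [|b bs IH] s /=; first by apply: runsW (runs_skip _) _ _ => //; store_eq.
apply: runsW (runs_seq (runs_push _ _ _) (IH _)) _ _; last by lia.
by store_eq.
Qed.

Lemma emit_polytime en es hdr :
  polytime_computable (fun x => let n := eval x 0 0 en in
    unary n ++ hdr ++ flatten [seq matrix x n e | e <- es]).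
Proof.
have [c0 H0] := comp_correct en; have [c Hc] := comp_correct_seq es.
(* The factor [K] is paid for by the exponent, as [K < 2 ^ K]; the rest of the exponent accounts for
   [Z ^ 3]. *)
pose K := 1000 * (size hdr + size es + 1).
apply: (@exec_polytime (emit_all en es hdr) _ (K + ((c0 + 2) * (c + 1)) * 3)) => x.
set y := size x + 2; set n := eval x 0 0 en.
have [Hn Rn] := H0 x 0 0 (size x) (leqnn _) isT isT; rewrite -/n -/y in Hn Rn.
(* The indices of the entries go up to [n], which may be as large as [y ^ c0]. [B] bounds them and
   the input size, [Z] the resulting values and costs. *)
pose B := y ^ c0 + size x; pose Z := (B + 2) ^ (c + 1).
have y2 : 2 <= y by rewrite /y; lia.
have c0gt : 0 < y ^ c0 by rewrite expn_gt0; lia.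
have BZ : B + 2 <= Z by rewrite /Z -{1}[B + 2]expn1 leq_pow2 //; lia.
have nZ : n <= Z by rewrite /B in BZ; lia.
have compP u v e : u <= n -> v <= n -> List.In e es -> eval x u v e <= Z /\
    forall d s, ready d x u v s -> runs (comp d e) s (upd s d (ones (eval x u v e))) Z.
  move=> un vn ees; have [] := Hc x u v B _ _ _ e ees; try by rewrite /B; lia.
  have L := leq_pow2 B (leq_addr 1 c).
  move=> L1 R; split; first exact: leq_trans L1 L.
  by move=> d s Hs; apply: runsW (R d s Hs) _ _.
have R4 : ready 4 x 0 0 (input_store x) by split=> // -[|[|[|[|[|[|[|z]]]]]]].
pose out := flatten [seq matrix x n e | e <- es].
pose o1 := catrev (false :: hdr) (ones n).
have R5 : ready 5 x 0 0 (layout x [::] 0 0 n 0 0) by split=> // -[|[|[|[|[|[|[|z]]]]]]].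
have Hm e : size (matrix x n e) = n ^ 2.
  by rewrite /matrix size_allpairs !size_iota.
have Ho : size out = size es * n ^ 2.
  rewrite /out; elim: (es) => //= e es' IH.
  by rewrite size_cat Hm IH mulSn.
have : runs (emit_all en es hdr) (input_store x)
    (upd (upd (upd (layout x (catrev out o1) 0 0 n 0 0) 0 [::]) 1 [::])
      0 (unary n ++ hdr ++ out)) (K * Z ^ 3).
  apply: runsW (runs_seq (runsW (Rn _ _ R4) (_ : _ = layout x [::] 0 0 n 0 0) (leqnn _))
    (runs_seq (@runs_copy 4 5 _ _ _ _ n R5 isT erefl)
    (runs_seq (@runs_addto 5 1 _ n _ _)
    (runs_seq (runsW (runs_emit_bits (false :: hdr) _)
                 (_ : _ = layout x o1 0 0 n 0 0) (leqnn _))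
    (runs_seq (runs_emit_matrices nZ _ compP _ (fun _ H => H))
    (runs_seq (runs_clear _ _) (@runs_mvbits 1 0 _ _))))))) _ _ => //.
  - layout_eq.
  - have -> : upd (layout x [::] 0 0 n 0 0) 5 (ones n) 1 = [::] by [].
    by rewrite cats0; layout_eq.
  - by rewrite expn_gt0; lia.
  - have -> : unary n ++ hdr ++ out = catrev (catrev out o1) [::].
      rewrite /o1 !catrevE cats0 !rev_cat !revK rev_nseq.
      by rewrite /unary -cats1 -!catA.
    layout_eq.
  - rewrite /upd /= /o1 !catrevE !size_cat !size_rev /= size_nseq Ho.
    have Zy : y <= Z by rewrite /y; lia.
    have c0Z : y ^ c0 <= Z by lia.
    have xZ : size x <= Z by lia.
    have ZZ : n ^ 2 <= Z ^ 3 by nia.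
    have Z3 : Z <= Z ^ 3 by nia.
    rewrite /K; nia.
move=> [m Hex Lm]; exists (upd (upd (upd (layout x (catrev out o1) 0 0 n 0 0) 0 [::]) 1 [::])
      0 (unary n ++ hdr ++ out)), m; split=> //.
apply: leq_trans Lm _; rewrite expnD leq_mul //.
  by apply: leq_trans (ltnW (@ltn_expl 2 K isT)) _; rewrite leq_exp2r //; rewrite /K; lia.
rewrite [_ * 3]mulnC [3 * _]mulnC (expnM _ _ 3) leq_exp2r // expnM leq_exp2r; last by lia.
rewrite /B addn2 expnD; have : size x + 2 <= y ^ 2 by rewrite /y; nia.
by nia.
Qed.

(** * Instances whose snapshots are matchings given by a function *)

Section Pairing.
Variables (n : nat) (sg : nat -> nat -> nat).

(** Asking for both equations yields a symmetric relation of degree at most one for an arbitrary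
    [sg]; fixed points are isolated. *)
Definition pair_adj (t : 'I_35) : rel 'I_n :=
  fun u v => [&& u != v, sg t u == v & sg t v == u].

Lemma pair_adj_sym t : symmetric (pair_adj t).
Proof. by move=> u v; rewrite /pair_adj eq_sym; congr andb; rewrite andbC. Qed.

Lemma pair_adj_irr t : irreflexive (pair_adj t).
Proof. by move=> u; rewrite /pair_adj eqxx. Qed.

Definition pair_graph := TemporalGraph pair_adj_sym pair_adj_irr.

Definition pair_instance : tds_instance := @TDSInstance n 35 pair_graph 3 6 isT.

Lemma pair_graph_degree : max_snapshot_degree pair_graph <= 1.
Proof.
apply/bigmax_leqP => t _; apply/bigmax_leqP => v _.
apply/card_le1_eqP => u w; rewrite !inE => /and3P[_ /eqP H1 _] /and3P[_ /eqP H2 _].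
by apply: val_inj; rewrite /= -H1 -H2.
Qed.

(** An interval of length at most 6 contains at most one of four times pairwise 7 apart, so meeting
    all of them takes four intervals. [A] is the activity relation, false outside the vertices. *)
Lemma pair_instance_sound : tds_yes pair_instance ->
  exists A : nat -> nat -> bool,
  [/\ forall u t1 t2 t3 t4, u < n -> t1 + 7 <= t2 -> t2 + 7 <= t3 -> t3 + 7 <= t4 ->
        ~~ [&& A u t1, A u t2, A u t3 & A u t4]
    & forall u t, u < n -> t < 35 -> A u t \/ (sg t u != u) && A (sg t u) t].
Proof.
move=> [/= S [[S1 S2 S3] Sdom]].
pose A (u t : nat) := [exists x in S, (x.1.1 == u :> nat) && (x.1.2 <= t <= x.2)].
exists A; split.
  move=> u t1 t2 t3 t4 un t12 t23 t34; apply/negP => /and4P[].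
  move=> /exists_inP[x1 Sx1 /andP[/eqP ux1 c1]] /exists_inP[x2 Sx2 /andP[/eqP ux2 c2]].
  move=> /exists_inP[x3 Sx3 /andP[/eqP ux3 c3]] /exists_inP[x4 Sx4 /andP[/eqP ux4 c4]].
  have := S3 (Ordinal un); rewrite leqNgt => /negP; apply.
  have L x : x \in S -> (x.2 : nat) <= x.1.2 + 6.
    by move=> Sx; have := S2 _ Sx; rewrite /interval_length; lia.
  have s : {subset [:: x1; x2; x3; x4] <= enum [set x in S | x.1.1 == Ordinal un]}.
    by move=> x; rewrite mem_enum !inE => /or4P[] /eqP->; apply/andP; split=> //; apply/eqP/val_inj.
  have l1 := L _ Sx1; have l2 := L _ Sx2; have l3 := L _ Sx3.
  have U : uniq [:: x1; x2; x3; x4].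
    by rewrite /= !inE !negb_or !andbT; apply/and3P; split; [apply/and3P; split|apply/andP; split|];
      apply/eqP => e; subst; lia.
  by rewrite cardE; exact: uniq_leq_size U s.
move=> u t un t35; have [w [[a [b [abS tab]]] uw]] := Sdom (Ordinal un) (Ordinal t35).
have Aw : A w t.
  by apply/exists_inP; exists (w, a, b) => //=; rewrite eqxx tab.
move: uw; rewrite inE => /orP[/eqP e|/and3P[nwu /eqP /= _ /eqP /= sgu]].
  by left; move: Aw; rewrite -e.
right; rewrite sgu Aw andbT; apply: contraNneq nwu => e.
by apply/eqP/val_inj.
Qed.

(* Every activity interval used is one of the five blocks [7 * b, 7 * b + 6]. *)
Lemma pair_instance_complete (D : nat -> nat -> bool) :
  (forall u, count (D u) (iota 0 5) <= 3) ->
  (forall u t, u < n -> t < 35 -> D u (t %/ 7) \/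
     [/\ sg t u < n, sg t u != u, sg t (sg t u) = u & D (sg t u) (t %/ 7)]) ->
  tds_yes pair_instance.
Proof.
move=> D3 Ddom.
pose lo b : 'I_35 := inord (7 * b); pose hi b : 'I_35 := inord (7 * b + 6).
have loE b : b < 5 -> lo b = 7 * b :> nat by move=> ?; rewrite inordK //; lia.
have hiE b : b < 5 -> hi b = 7 * b + 6 :> nat by move=> ?; rewrite inordK //; lia.
pose I (u : 'I_n) := [seq (u, lo b, hi b) | b <- iota 0 5 & D u b].
pose S := [set x : triple 'I_n 35 | x \in I x.1.1].
have SP x : x \in S -> exists2 b, b < 5 & x.1.2 = lo b /\ x.2 = hi b.
  rewrite inE => /mapP[b]; rewrite mem_filter mem_iota => /andP[_ b5] e.
  by exists b => //; rewrite e.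
exists S; split; first split.
- by move=> x /SP[b b5 [e1 e2]]; rewrite /activity_interval e1 e2 loE ?hiE //; lia.
- by move=> x /SP[b b5 [e1 e2]]; rewrite /interval_length e1 e2 loE ?hiE //=; lia.
- move=> u /=; apply: leq_trans (D3 u); rewrite -size_filter -(size_map (fun b => (u, lo b, hi b))).
  apply: leq_trans (card_size _); apply: subset_leq_card; apply/subsetP => x.
  by rewrite !inE => /andP[xI /eqP e]; rewrite -e.
have act (u : 'I_n) (t : 'I_35) : D u (t %/ 7) -> active S u t.
  move=> Du; exists (lo (t %/ 7)), (hi (t %/ 7)).
  have b5 : t %/ 7 < 5 by have := ltn_ord t; lia.
  rewrite loE // hiE // inE /=; split; last by lia.
  by apply/mapP; exists (t %/ 7) => //; rewrite mem_filter Du mem_iota.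
move=> u t; have [/act H|[H1 H2 H3 H4]] := Ddom u t (ltn_ord u) (ltn_ord t).
  by exists u; rewrite inE eqxx.
exists (Ordinal H1); split; first exact: act.
rewrite inE; apply/orP; right; apply/and3P; split.
- by rewrite -val_eqE.
- by apply/eqP; rewrite /= H3.
- by [].
Qed.

End Pairing.

(** * From a clause-variable incidence table to a pairing *)
Section Gadget.
Variables (M V : nat) (inc : nat -> nat -> nat).
Hypotheses (M_gt0 : 0 < M) (V_gt0 : 0 < V).

(* [inc m v] is 1 (resp. 2) when the variable [v] occurs positively (resp.
   negatively) in the clause [m], and any other number when it does not occur. *)
Definition literal (a : nat -> bool) m v :=
  (inc m v == 1) && a v || (inc m v == 2) && ~~ a v.

Definition satisfiable :=
  exists a, forall m, m < M -> exists2 v, v < V & literal a m v.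

Definition mid m v k := (m * V + v) * 4 + k.

(* 0 for a free slot, otherwise the successor of the mate of [mid m v k] at time
   [t], which is [mid m v k] itself for an isolated vertex. The kinds [k] are
   0: the variable [v] in the clause [m], 1: its negation, 2: the position [v]
   of the clause [m], 3: the link between the positions [v] and [v.+1]. *)
Definition mate t k m v : nat :=
  let self := (mid m v k).+1 in
  if t == 0 then self else
  if t == 7 then
    if k == 2 then if v == 0 then self else (mid m v.-1 3).+1
    else if k == 3 then if v.+1 == V then 0 else (mid m v.+1 2).+1
    else self
  else if t == 14 then
    if k == 0 then (mid ((m + M.-1) %% M) v 1).+1
    else if k == 1 then (mid ((m + 1) %% M) v 0).+1
    else if k == 2 then if v.+1 == V then self else (mid m v 3).+1
    else if v.+1 == V then 0 else (mid m v 2).+1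
  else if t == 21 then
    if k == 0 then if inc m v == 1 then (mid m v 2).+1 else 0
    else if k == 1 then if inc m v == 2 then (mid m v 2).+1 else 0
    else if k == 2 then
      if inc m v == 1 then (mid m v 0).+1
      else if inc m v == 2 then (mid m v 1).+1 else self
    else self
  else if t == 22 then
    if k == 0 then (mid m v 1).+1 else if k == 1 then (mid m v 0).+1 else 0
  else 0.

(* The vertex [a * 6 + 5] is the vertex [a] of the gadget and [a * 6 + r] with
   [r < 5] its [r]-th supplier, active in the blocks r, r+1 and r+2 modulo 5. *)
Definition sigma t u : nat :=
  let r := u %% 6 in
  let a := u %/ 6 in
  let w := mate t (a %% 4) (a %/ 4 %/ V) (a %/ 4 %% V) in
  if r == 5 then if w == 0 then a * 6 + t %/ 7 else w.-1 * 6 + 5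
  else if r == t %/ 7 then if w == 0 then a * 6 + 5 else u
  else a * 6 + (2 * (t %/ 7) + 5 - r) %% 5.

Definition nv := M * V * 24.

Lemma sigmaE t m v k r : v < V -> k < 4 -> r < 6 ->
  sigma t (mid m v k * 6 + r) =
  if r == 5 then if mate t k m v is w.+1 then w * 6 + 5 else mid m v k * 6 + t %/ 7
  else if r == t %/ 7 then
    if mate t k m v is w.+1 then mid m v k * 6 + r else mid m v k * 6 + 5
  else mid m v k * 6 + (2 * (t %/ 7) + 5 - r) %% 5.
Proof.
move=> vV k4 r6; rewrite /sigma modnMDl divnMDl // (divn_small r6) (modn_small r6) addn0.
have -> : mid m v k %% 4 = k by rewrite /mid modnMDl modn_small.
have -> : mid m v k %/ 4 = m * V + v by rewrite /mid divnMDl // (divn_small k4) addn0.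
rewrite modnMDl divnMDl // (divn_small vV) (modn_small vV) addn0.
by case: (mate t k m v).
Qed.

Lemma mid_lt m v k r : m < M -> v < V -> k < 4 -> r < 6 -> mid m v k * 6 + r < nv.
Proof.
move=> mM vV k4 r6; rewrite /mid /nv.
have : (m * V + v).+1 <= M * V by apply: leq_trans (_ : m.+1 * V <= _); [rewrite mulSn; lia|rewrite leq_mul2r; lia].
lia.
Qed.

Lemma midP u : u < nv -> exists m v k r,
  [/\ m < M, v < V, k < 4, r < 6 & u = mid m v k * 6 + r].
Proof.
move=> un; exists (u %/ 6 %/ 4 %/ V), (u %/ 6 %/ 4 %% V), (u %/ 6 %% 4), (u %% 6).
split; rewrite ?ltn_mod //; last by rewrite /mid -!divn_eq.
by rewrite -!divnMA ltn_divLR //; [rewrite /nv in un; lia|lia].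
Qed.

(** Forced activities propagate: the edges at 14 and 22 carry the value of a variable around the
    cycle of clauses, and a clause without true literal pushes the obligation 7 along its path until
    the last position has all four obligations. *)
Lemma gadget_sound : tds_yes (pair_instance nv sigma) -> satisfiable.
Proof.
move/pair_instance_sound => [A [four dom]].
pose X k m v t := A (mid m v k * 6 + 5) t.
have F k m v t1 t2 t3 t4 : m < M -> v < V -> k < 4 ->
    t1 + 7 <= t2 -> t2 + 7 <= t3 -> t3 + 7 <= t4 ->
    X k m v t1 -> X k m v t2 -> X k m v t3 -> X k m v t4 -> False.
  move=> mM vV k4 l1 l2 l3 H1 H2 H3 H4.
  have := four (mid m v k * 6 + 5) t1 t2 t3 t4 (mid_lt mM vV k4 (isT : 5 < 6)) l1 l2 l3.
  by move: H1 H2 H3 H4; rewrite /X => -> -> -> ->.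
have E k m v t w : m < M -> v < V -> k < 4 -> t < 35 -> mate t k m v = w.+1 ->
    X k m v t \/ (w != mid m v k) && A (w * 6 + 5) t.
  move=> mM vV k4 t35 mt; have := dom _ t (mid_lt mM vV k4 (isT : 5 < 6)) t35.
  rewrite sigmaE //= mt => -[H|/andP[H1 H2]]; [by left|right].
  by rewrite H2 andbT; apply: contraNneq H1 => ->.
have I k m v t : m < M -> v < V -> k < 4 -> t < 35 -> mate t k m v = (mid m v k).+1 ->
    X k m v t.
  by move=> mM vV k4 t35 /E -/(_ mM vV k4 t35)[] //; rewrite eqxx.
(* Activity of the copy [P] at 14 encodes the value false. *)
pose pf m v := X 0 m v 14.
have pfN m v t : m < M -> v < V -> t \in [:: 21; 22] -> X 0 m v t -> pf m v -> False.
  move=> mM vV tt X1 X2.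
  have i0 := I 0 m v 0 mM vV isT isT erefl; have i7 := I 0 m v 7 mM vV isT isT erefl.
  by move: tt; rewrite !inE => /orP[]/eqP et; apply: (F 0 m v 0 7 14 t) => //; rewrite et.
have qfN m v t : m < M -> v < V -> t \in [:: 21; 22] -> X 1 m v t -> pf ((m + 1) %% M) v.
  move=> mM vV tt X1.
  have i0 := I 1 m v 0 mM vV isT isT erefl; have i7 := I 1 m v 7 mM vV isT isT erefl.
  have := E 1 m v 14 _ mM vV isT isT erefl => -[X2|/andP[] //].
  by exfalso; move: tt; rewrite !inE => /orP[]/eqP et; apply: (F 1 m v 0 7 14 t) => //; rewrite et.
(* If [P] takes 14 it cannot take 22, so [Q] must; then [Q] is not active at 14 and the [P] of the
   next clause is. *)
have pfS m v : m < M -> v < V -> pf m v -> pf ((m + 1) %% M) v.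
  move=> mM vV pfm; have [/pfN|] := E 0 m v 22 _ mM vV isT isT erefl.
    by move/(_ mM vV isT pfm).
  by move=> /andP[_ X1]; apply: (qfN m v 22).
have pf_up v m : v < V -> m < M -> pf 0 v -> pf m v.
  move=> vV; elim: m => // m IH mM /IH -/(_ (ltnW mM)) /pfS -/(_ (ltnW mM) vV).
  by rewrite modn_small addn1.
(* The cycle closes up: going forward from [m] eventually reaches the clause 0. *)
have pf_all v m : v < V -> m < M -> pf m v -> pf 0 v.
  move=> vV mM; have [d] := ubnP (M - m); elim: d m mM => // d IH m mM dM /pfS -/(_ mM vV).
  case: (ltngtP m.+1 M) => [m1||e]; [|lia|].
    by rewrite modn_small addn1 //; apply: IH; lia.
  by rewrite addn1 e modnn.
exists (fun v => ~~ pf 0 v) => m mM.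
have [[v] vV lv|no] : (exists2 v, v < V & literal (fun v => ~~ pf 0 v) m v) \/
    forall v, v < V -> ~~ literal (fun v => ~~ pf 0 v) m v.
- have [/hasP[v]|/hasPn H] := boolP (has (literal (fun v => ~~ pf 0 v) m) (iota 0 V)).
    by rewrite mem_iota => vV ?; left; exists v.
  by right => v vV; apply: H; rewrite mem_iota.
- by exists v.
exfalso.
have C0 v : v < V -> X 2 m v 0 by move=> vV; apply: I.
(* A false literal cannot help at 21: for a positive occurrence [P] is spent at 14, and for a
   negative one [Q] at 21 would make the variable false. *)
have C21 v : v < V -> X 2 m v 21.
  move=> vV; have := no v vV; rewrite /literal negb_or negbK !negb_and negbK.
  case e1: (inc m v == 1) => /=.
    have [//|/andP[_ X1]] := E 2 m v 21 (mid m v 0) mM vV isT isT ltac:(by rewrite /mate /= e1).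
    rewrite (eqP e1) /= andbT => pf0; case: (pfN m v 21) => //; exact: pf_up.
  case e2: (inc m v == 2) => /=.
    have [//|/andP[_ X1]] := E 2 m v 21 (mid m v 1) mM vV isT isT
      ltac:(by rewrite /mate /= e1 e2).
    have := qfN m v 21 mM vV isT X1 => /pf_all -/(_ vV); rewrite ltn_mod => -/(_ M_gt0).
    by move=> ->.
  by move=> _; apply: I => //; rewrite /mate /= e1 e2.
(* A position holding 0, 7 and 21 leaves 14 to its link; the link, also holding 0 and 21, leaves 7
   to the next position. *)
have C7 v : v < V -> X 2 m v 7.
  elim: v => [|v IH] vV; first by apply: I.
  have {IH}C7 := IH (ltnW vV).
  have [X14|/andP[_ R14]] := E 2 m v 14 (mid m v 3) mM (ltnW vV) isT isT
    ltac:(by rewrite /mate /= (ltn_eqF vV)).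
    by case: (F 2 m v 0 7 14 21) => //; rewrite ?C0 ?C21 ?(ltnW vV).
  have [R7|/andP[//]] := E 3 m v 7 (mid m v.+1 2) mM (ltnW vV) isT isT
    ltac:(by rewrite /mate /= (ltn_eqF vV)).
  have r0 := I 3 m v 0 mM (ltnW vV) isT isT erefl.
  have r21 := I 3 m v 21 mM (ltnW vV) isT isT erefl.
  by case: (F 3 m v 0 7 14 21) => //; exact: ltnW.
(* The last position is isolated at 14, which gives it a fourth obligation. *)
have lV : V.-1 < V by lia.
apply: (F 2 m V.-1 0 7 14 21) => //; [exact: C0|exact: C7| |exact: C21].
by apply: I => //; rewrite /mate /= prednK // eqxx.
Qed.

(** [w] is the first true literal of the clause. Its position skips 21, covered by that literal;
    earlier positions skip 14 and later ones skip 7, covered by the links, which switch from 14 to 7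
    at [w]. The times 21 and 22 share block 3. *)
Definition main_block a k m v b : bool :=
  let w := find (literal a m) (iota 0 V) in
  if k == 0 then b \in [:: 0; 1; if a v then 3 else 2]
  else if k == 1 then b \in [:: 0; 1; if a v then 2 else 3]
  else if k == 2 then
    b \in if v < w then [:: 0; 1; 3] else if v == w then [:: 0; 1; 2] else [:: 0; 2; 3]
  else b \in if v < w then [:: 0; 3; 2] else [:: 0; 3; 1].

Definition block a u b : bool :=
  let r := u %% 6 in
  let c := u %/ 6 in
  if r == 5 then main_block a (c %% 4) (c %/ 4 %/ V) (c %/ 4 %% V) b
  else (b + 5 - r) %% 5 < 3.

Lemma blockE a m v k r b : v < V -> k < 4 -> r < 6 ->
  block a (mid m v k * 6 + r) b =
  if r == 5 then main_block a k m v b else (b + 5 - r) %% 5 < 3.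
Proof.
move=> vV k4 r6; rewrite /block modnMDl divnMDl // (divn_small r6) (modn_small r6) addn0.
have -> : mid m v k %% 4 = k by rewrite /mid modnMDl modn_small.
have -> : mid m v k %/ 4 = m * V + v by rewrite /mid divnMDl // (divn_small k4) addn0.
by rewrite modnMDl divnMDl // (divn_small vV) (modn_small vV) addn0.
Qed.

Lemma block_count a u : count (block a u) (iota 0 5) <= 3.
Proof.
rewrite /block; have := ltn_pmod u (isT : 0 < 6); move: (u %% 6) => r.
case: r => [|[|[|[|[|[|r]]]]]] // _; rewrite /= /main_block.
case: ifP => _; first by case: (a _).
case: ifP => _; first by case: (a _).
case: ifP => _; case: ifP => //= _; by case: ifP.
Qed.

(** The reflection of [r] about [b] modulo 5 fixes only [b] and negates the difference [b - r]: the
    inactive differences 3 and 4 become the active ones 2 and 1. *)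
Lemma supplier_pair b r : b < 5 -> r < 5 -> ~~ ((b + 5 - r) %% 5 < 3) ->
  let r' := (2 * b + 5 - r) %% 5 in
  [/\ r != b, r' != b, r' != r, (2 * b + 5 - r') %% 5 = r & (b + 5 - r') %% 5 < 3].
Proof.
by case: b => [|[|[|[|[|b]]]]] //; case: r => [|[|[|[|[|r]]]]].
Qed.

(** The reverse equation for [mate] and the difference of kinds are what [pair_adj] demands of a
    partner. That one of the two is active is the design of [main_block], checked time by time. *)
Lemma mate_active a t k m v w : (forall m, m < M -> exists2 v, v < V & literal a m v) ->
  m < M -> v < V -> k < 4 -> mate t k m v = w.+1 ->
  main_block a k m v (t %/ 7) \/
  exists m' v' k', [/\ m' < M /\ v' < V, k' < 4 /\ k' != k, w = mid m' v' k',
    mate t k' m' v' = (mid m v k).+1 & main_block a k' m' v' (t %/ 7)].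
Proof.
move=> Ha mM vV k4.
have [lw lw'] : find (literal a m) (iota 0 V) < V /\
    literal a m (find (literal a m) (iota 0 V)).
  have [z zV lz] := Ha m mM.
  have hz : has (literal a m) (iota 0 V) by apply/hasP; exists z => //; rewrite mem_iota.
  have := nth_find 0 hz; move: hz; rewrite has_find size_iota => hz.
  by rewrite nth_iota.
rewrite /main_block {1}/mate.
case: (t =P 0) => [->|_].
  by move=> _; left; case: k k4 => [|[|[|[|k]]]] //= _; do ?case: ifP.
case: (t =P 7) => [->|_].
  case: k k4 => [|[|[|[|k]]]] //= _; try by left.
    case: (v =P 0) => [->|v0].
      by move=> _; left; case: (find _ _).
    move=> [<-]; case: (ltngtP v (find (literal a m) (iota 0 V))) => vw; try by left.
    right; exists m, v.-1, 3; split=> //; [lia| |].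
      by rewrite /mate /= prednK ?(ltn_eqF vV) //; lia.
    by rewrite /main_block /= ltnNge (_ : _ <= v.-1) //; lia.
  case: (v.+1 =P V) => // vV1 [<-].
  case: ltnP => vw; last by left.
  right; exists m, v.+1, 2; split=> //; [lia|rewrite /main_block /=].
  by case: (ltngtP v.+1 (find (literal a m) (iota 0 V))) => //; lia.
case: (t =P 14) => [->|_].
  have modM b : (b %% M < M) by rewrite ltn_mod.
  case: k k4 => [|[|[|[|k]]]] //= _.
  - move=> [<-]; case: ifP => av; last by left.
    right; exists ((m + M.-1) %% M), v, 1; split=> //; last by rewrite /main_block av.
    (* [m + M.-1] modulo [M] is the clause before [m] on the cycle, and its successor is [m]
       again. *)
    by rewrite /mate /= modnDml -addnA addn1 prednK // modnDr modn_small.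
  - move=> [<-]; case: ifP => av; first by left.
    right; exists ((m + 1) %% M), v, 0; split=> //; last by rewrite /main_block av.
    by rewrite /mate /= modnDml -addnA add1n prednK // modnDr modn_small.
  - case: (v.+1 =P V) => [vV1|vV1] [<-].
      by left; case: (ltngtP v (find (literal a m) (iota 0 V))) => //; lia.
    case: (ltngtP v (find (literal a m) (iota 0 V))) => vw; try by left.
    right; exists m, v, 3; split=> //; last by rewrite /main_block /= vw.
    by rewrite /mate /=; case: eqP.
  - case: (v.+1 =P V) => // vV1 [<-].
    case: ltnP => vw; first by left.
    right; exists m, v, 2; split=> //; first by rewrite /mate /=; case: eqP.
    by rewrite /main_block /=; case: (ltngtP v (find (literal a m) (iota 0 V))) => //; lia.
case: (t =P 21) => [->|_].
  case: k k4 => [|[|[|[|k]]]] //= _; last by left; case: ifP.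
  - case e1: (inc m v == 1) => // -[<-]; case: ifP => av; first by left.
    right; exists m, v, 2; split=> //; first by rewrite /mate /= e1.
    (* Here the literal is false, whereas the chosen position carries a true one; so [v] is another
       position, which is active at 21. *)
    rewrite /main_block /=; case: ltngtP => // e.
    by move: lw'; rewrite -e /literal (eqP e1) av.
  - case e1: (inc m v == 2) => // -[<-]; case: ifP => av; last by left.
    right; exists m, v, 2; split=> //; first by rewrite /mate /= (eqP e1).
    rewrite /main_block /=; case: ltngtP => // e.
    by move: lw'; rewrite -e /literal (eqP e1) av.
  - case: ltngtP => vw; try by left.
    (* At the chosen position the literal is true, so the linked copy is active at 21. *)
    move: lw'; rewrite -vw /literal; case e1: (inc m v == 1) => /=.
      rewrite (eqP e1) orbF => av [<-]; right; exists m, v, 0; split=> //.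
        by rewrite /mate /= e1.
      by rewrite /main_block /= av.
    case e2: (inc m v == 2) => //= av [<-]; right; exists m, v, 1; split=> //.
      by rewrite /mate /= e2.
    by rewrite /main_block /= (negbTE av).
case: (t =P 22) => [->|_] //.
case: k k4 => [|[|k]] //= _ [<-]; case: ifP => av; try by left.
  by right; exists m, v, 1; split=> //; rewrite /main_block /= av.
by right; exists m, v, 0; split=> //; rewrite /main_block /= av.
Qed.

Lemma gadget_complete : satisfiable -> tds_yes (pair_instance nv sigma).
Proof.
move=> [a Ha]; apply: (@pair_instance_complete _ _ (block a)); first exact: block_count.
move=> u t /midP[m [v [k [r [mM vV k4 r6 ->]]]]] t35.
have b5 : t %/ 7 < 5 by lia.
have b6 : t %/ 7 < 6 by lia.
rewrite blockE // sigmaE //; case: (r =P 5) => [->|r5].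
  case mt: (mate t k m v) => [|w].
    (* A free slot is matched with the supplier of index [t %/ 7], whose activity starts in that
       very block. *)
    right; split.
    - exact: mid_lt.
    - by rewrite eqn_add2l; lia.
    - by rewrite sigmaE // (ltn_eqF b5) eqxx mt.
    - by rewrite blockE // (ltn_eqF b5) addnC -addnBA // subnn.
  have [|[m' [v' [k' [[m'M v'V] [k'4 kk'] ew mt' D']]]]] := mate_active Ha mM vV k4 mt.
    by left.
  right; rewrite {}ew; split.
  - exact: mid_lt.
  - by rewrite /mid; apply/eqP; lia.
  - by rewrite sigmaE //= mt'.
  - by rewrite blockE.
have {}r5 : r < 5 by lia.
have [|nD] := boolP ((t %/ 7 + 5 - r) %% 5 < 3); first by left.
right; have [rb rb' rr e D] := supplier_pair b5 r5 nD.
have r'5 : (2 * (t %/ 7) + 5 - r) %% 5 < 5 by rewrite ltn_mod.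
have r'6 : (2 * (t %/ 7) + 5 - r) %% 5 < 6 by apply: leq_trans r'5 _.
rewrite (negbTE rb); split.
- exact: mid_lt.
- by rewrite eqn_add2l.
- by rewrite sigmaE // (ltn_eqF r'5) (negbTE rb') e.
- by rewrite blockE // (ltn_eqF r'5).
Qed.

Lemma gadget_correct : tds_yes (pair_instance nv sigma) <-> satisfiable.
Proof. by split; [exact: gadget_sound | exact: gadget_complete]. Qed.

End Gadget.

(** * Logic, division and finite tables as expressions *)

Definition ENot a := ESub (EConst 1) a.
Definition ELt a b := ESub b a.
Definition EEq a b := ENot (EAdd (ESub a b) (ESub b a)).
Definition EIf c a b := EAdd (EMul (ENot (ENot c)) a) (EMul (ENot c) b).
Definition EDivn a b := EDiv a (ESub b (EConst 1)).
Definition EModn a b := ESub a (EMul (EDivn a b) b).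
Definition ESucc a := EAdd a (EConst 1).

Section Eval.
Variables (x : seq bool) (u v : nat).
Notation ev := (eval x u v).

(** With nonzero values as true, sums are disjunctions, products are conjunctions, and a truncated
    difference expresses a strict inequality. *)
Definition truth e := ev e != 0.

Lemma truth_not a : truth (ENot a) = ~~ truth a.
Proof. by rewrite /truth /=; case: (ev a). Qed.

Lemma truth_lt a b : truth (ELt a b) = (ev a < ev b).
Proof. by rewrite /truth /= subn_eq0 ltnNge. Qed.

Lemma truth_or a b : truth (EAdd a b) = truth a || truth b.
Proof. by rewrite /truth /= addn_eq0 negb_and. Qed.

Lemma truth_and a b : truth (EMul a b) = truth a && truth b.
Proof. by rewrite /truth /= muln_eq0 negb_or. Qed.

Lemma truth_eq a b : truth (EEq a b) = (ev a == ev b).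
Proof. by rewrite truth_not /truth /= addn_eq0 negbK !subn_eq0 eqn_leq. Qed.

Lemma eval_eq a b : ev (EEq a b) = (ev a == ev b).
Proof. by rewrite -truth_eq /truth /=; case: (_ + _). Qed.

Lemma eval_if c a b : ev (EIf c a b) = if truth c then ev a else ev b.
Proof. by rewrite /truth /=; case: (ev c) => [|n] /=; rewrite ?mul0n ?mul1n ?addn0. Qed.

Lemma eval_divn a b : 0 < ev b -> ev (EDivn a b) = ev a %/ ev b.
Proof. by rewrite /= subn1; case: (ev b). Qed.

Lemma eval_modn a b : 0 < ev b -> ev (EModn a b) = ev a %% ev b.
Proof.
move=> b0; have -> : ev (EModn a b) = ev a - ev (EDivn a b) * ev b by [].
by rewrite eval_divn // {1}(divn_eq (ev a) (ev b)) addKn.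
Qed.

Lemma eval_succ a : ev (ESucc a) = (ev a).+1.
Proof. by rewrite /= addn1. Qed.

Fixpoint EPow a n := if n is n'.+1 then EMul a (EPow a n') else EConst 1.

Lemma eval_pow a n : ev (EPow a n) = ev a ^ n.
Proof. by elim: n => //= n ->; rewrite expnS. Qed.

(** A finite predicate becomes the disjunction of the equalities with its elements; the rules of a
    tileset enter the expressions in this way. *)
Definition ETab K (P : pred nat) e :=
  foldr (fun g s => if P g then EAdd (EEq e (EConst g)) s else s) (EConst 0) (iota 0 K).

Definition ETab2 K1 K2 (P : rel nat) e1 e2 :=
  foldr (fun g s => EAdd (EMul (EEq e1 (EConst g)) (ETab K2 (P g) e2)) s)
    (EConst 0) (iota 0 K1).

Lemma truth_tab K P e : ev e < K -> truth (ETab K P e) = P (ev e).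
Proof.
move=> eK; have -> : truth (ETab K P e) = has (fun g => P g && (ev e == g)) (iota 0 K).
  rewrite /ETab; elim: (iota 0 K) => //= g s <-.
  by case: (P g) => //=; rewrite truth_or truth_eq.
apply/hasP/idP => [[g _ /andP[Pg /eqP->]] //|Pe].
by exists (ev e); rewrite ?mem_iota ?Pe ?eqxx.
Qed.

Lemma truth_tab2 K1 K2 P e1 e2 : ev e1 < K1 -> ev e2 < K2 ->
  truth (ETab2 K1 K2 P e1 e2) = P (ev e1) (ev e2).
Proof.
move=> e1K e2K; have -> : truth (ETab2 K1 K2 P e1 e2) =
    has (fun g => (ev e1 == g) && P g (ev e2)) (iota 0 K1).
  rewrite /ETab2; elim: (iota 0 K1) => //= g s <-.
  by rewrite truth_or truth_and truth_eq truth_tab.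
apply/hasP/idP => [[g _ /andP[/eqP-> Pg]] //|Pe].
by exists (ev e1); rewrite ?mem_iota ?Pe ?eqxx.
Qed.

End Eval.

Definition truthE := (truth_not, truth_lt, truth_or, truth_and, truth_eq).
Definition evalE := (eval_eq, eval_if, eval_succ).

(** * The pairing is computed by expressions *)

(** This is the conclusion of [NP_hard] for a single language. *)
Definition poly_reducible (L : seq bool -> Prop) (P : problem) : Prop :=
  exists2 f : seq bool -> seq bool, polytime_computable f &
    forall x, exists I : instance P, f x = encode I /\ (L x <-> yes I).

Definition restricted_TDS : problem :=
  @restrict TimelineDominatingSet (fun I : tds_instance =>
    [/\ lifetime I = 35, activity I = 3, maxlen I = 6
      & max_snapshot_degree (graph I) <= 1]).

Section GadgetExpr.
Variables (M V : seq bool -> nat) (inc : seq bool -> nat -> nat -> nat).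
Variables (eM eV : expr) (einc : expr -> expr -> expr).
Hypothesis eMP : forall x u v, eval x u v eM = M x.
Hypothesis eVP : forall x u v, eval x u v eV = V x.
Hypothesis eincP : forall x u v a b,
  eval x u v (einc a b) = inc x (eval x u v a) (eval x u v b).
Hypotheses (M_gt0 : forall x, 0 < M x) (V_gt0 : forall x, 0 < V x).

Definition emid m v k := EAdd (EMul (EAdd (EMul m eV) v) (EConst 4)) (EConst k).

(** The time [t] is a number, not an expression: every snapshot has its own expression, and the
    tests on [t] are resolved when it is built. *)
Definition emate t k m v :=
  let self := ESucc (EAdd (EMul (EAdd (EMul m eV) v) (EConst 4)) k) in
  let kis i a b := EIf (EEq k (EConst i)) a b in
  let last a b := EIf (EEq (ESucc v) eV) a b in
  let mate m v k := ESucc (emid m v k) in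
  let zero := EConst 0 in
  if t == 0 then self else
  if t == 7 then
    kis 2 (EIf (EEq v zero) self (mate m (ESub v (EConst 1)) 3))
      (kis 3 (last zero (mate m (ESucc v) 2)) self)
  else if t == 14 then
    kis 0 (mate (EModn (EAdd m (ESub eM (EConst 1))) eM) v 1)
      (kis 1 (mate (EModn (EAdd m (EConst 1)) eM) v 0)
        (kis 2 (last self (mate m v 3)) (last zero (mate m v 2))))
  else if t == 21 then
    kis 0 (EIf (EEq (einc m v) (EConst 1)) (mate m v 2) zero)
      (kis 1 (EIf (EEq (einc m v) (EConst 2)) (mate m v 2) zero)
        (kis 2 (EIf (EEq (einc m v) (EConst 1)) (mate m v 0)
                 (EIf (EEq (einc m v) (EConst 2)) (mate m v 1) self))
          self))
  else if t == 22 then kis 0 (mate m v 1) (kis 1 (mate m v 0) zero)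
  else zero.

Definition esigma t e :=
  let r := EModn e (EConst 6) in
  let a := EDivn e (EConst 6) in
  let q := EDivn a (EConst 4) in
  let w := emate t (EModn a (EConst 4)) (EDivn q eV) (EModn q eV) in
  let at_ i := EAdd (EMul a (EConst 6)) i in
  EIf (EEq r (EConst 5))
    (EIf (EEq w (EConst 0)) (at_ (EConst (t %/ 7)))
      (EAdd (EMul (ESub w (EConst 1)) (EConst 6)) (EConst 5)))
    (EIf (EEq r (EConst (t %/ 7)))
      (EIf (EEq w (EConst 0)) (at_ (EConst 5)) e)
      (at_ (EModn (ESub (EConst (2 * (t %/ 7) + 5)) r) (EConst 5)))).

Definition eadj t :=
  EMul (ENot (EEq EU EV)) (EMul (EEq (esigma t EU) EV) (EEq (esigma t EV) EU)).

Lemma eval_emid x u v a b k :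
  eval x u v (emid a b k) = mid (V x) (eval x u v a) (eval x u v b) k.
Proof. by rewrite /= eVP. Qed.

Lemma eval_emate t x u v k a b :
  eval x u v (emate t k a b) =
  mate (M x) (V x) (inc x) t (eval x u v k) (eval x u v a) (eval x u v b).
Proof.
have eM0 : 0 < eval x u v eM by rewrite eMP.
have self : eval x u v (EAdd (EMul (EAdd (EMul a eV) b) (EConst 4)) k) =
  mid (V x) (eval x u v a) (eval x u v b) (eval x u v k) by rewrite /= eVP.
have sub1 e : eval x u v (ESub e (EConst 1)) = (eval x u v e).-1 by rewrite /= subn1.
have add e f : eval x u v (EAdd e f) = eval x u v e + eval x u v f by [].
have cst c : eval x u v (EConst c) = c by [].
rewrite /emate /mate.
case: (t == 0); last case: (t == 7); last case: (t == 14); last case: (t == 21);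
  last case: (t == 22); rewrite ?(evalE, truthE, self, eval_emid, eVP, sub1, eincP, eval_modn, cst) //
   ?(add, sub1, eMP, cst) //.
by rewrite addn1.
Qed.

Lemma eval_esigma t x u v e :
  eval x u v (esigma t e) = sigma (M x) (V x) (inc x) t (eval x u v e).
Proof.
rewrite /esigma /sigma.
have eV0 : 0 < eval x u v eV by rewrite eVP.
set w := emate _ _ _ _.
have cst c : eval x u v (EConst c) = c by [].
have sub1 f : eval x u v (ESub f (EConst 1)) = (eval x u v f).-1 by rewrite /= subn1.
have add f g : eval x u v (EAdd f g) = eval x u v f + eval x u v g by [].
have mul f g : eval x u v (EMul f g) = eval x u v f * eval x u v g by [].
have sub f g : eval x u v (ESub f g) = eval x u v f - eval x u v g by [].
have D6 : eval x u v (EDivn e (EConst 6)) = eval x u v e %/ 6 by rewrite eval_divn.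
have M6 : eval x u v (EModn e (EConst 6)) = eval x u v e %% 6 by rewrite eval_modn.
have wE : eval x u v w = mate (M x) (V x) (inc x) t (eval x u v e %/ 6 %% 4)
    (eval x u v e %/ 6 %/ 4 %/ V x) (eval x u v e %/ 6 %/ 4 %% V x).
  by rewrite /w eval_emate ?eval_divn ?eval_modn ?eval_divn ?cst ?eVP.
by rewrite !(evalE, truthE) wE M6 !add !mul sub1 wE D6 eval_modn // sub M6.
Qed.

Definition reduction (x : seq bool) : tds_instance :=
  pair_instance (nv (M x) (V x)) (sigma (M x) (V x) (inc x)).

(** Lifetime, activity and length are constants, so after the unary size the encoding is a fixed
    header followed by 35 matrices, each given by one expression. *)
Lemma reduction_polytime : polytime_computable (fun x => tds_encode (reduction x)).
Proof.
pose en := EMul (EMul eM eV) (EConst 24).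
pose hdr := unary 35 ++ binary 3 ++ binary 6.
have := emit_polytime en [seq eadj t | t <- iota 0 35] hdr.
congr (polytime_computable _); apply: functional_extensionality => x; cbn zeta.
have -> : eval x 0 0 en = nv (M x) (V x) by rewrite /en /= eMP eVP.
rewrite /tds_encode; set n := nv (M x) (V x).
have E o : unary n ++ hdr ++ o = unary n ++ unary 35 ++ binary 3 ++ binary 6 ++ o.
  by rewrite /hdr -!catA.
rewrite E; apply: (congr1 (fun o => unary n ++ unary 35 ++ binary 3 ++ binary 6 ++ o)).
rewrite -map_comp -(val_enum_ord 35) -map_comp; congr flatten.
apply/eq_map => t /=; rewrite /matrix.
rewrite -(val_enum_ord n) allpairs_mapl allpairs_mapr; apply: eq_allpairs => u v /=.
rewrite -/(truth x u v (eadj t)) /eadj !truthE !eval_esigma //=.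
Qed.

Lemma reduction_NP_hard (L : seq bool -> Prop) :
  (forall x, L x <-> satisfiable (M x) (V x) (inc x)) ->
  poly_reducible L restricted_TDS.
Proof.
move=> HL; exists (fun x => tds_encode (reduction x)); first exact: reduction_polytime.
move=> x.
have P : [/\ lifetime (reduction x) = 35, activity (reduction x) = 3, maxlen (reduction x) = 6
        & max_snapshot_degree (graph (reduction x)) <= 1].
  by split=> //; exact: pair_graph_degree.
exists (exist _ (reduction x) P); split=> //; rewrite HL; apply: iff_sym.
exact: gadget_correct.
Qed.

End GadgetExpr.

(** * From tilings to clauses *)
Record tileset := Tileset {
  ntiles : nat;
  hrel : rel nat;
  vrel : rel nat;
  valid : pred nat;
  first_col : pred nat;
  last_col : pred nat;
  last_row : pred nat;
  (* input letter ([inp_code]) and head mark of a cell of the first row *)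
  first_row : nat -> bool -> pred nat
}.

Section Tiling.
Variables (S : tileset) (x : seq bool) (N : nat).
Let K := ntiles S.
Let W := 2 * N + 1.

(** The input starts in column [N], the middle of the [2 * N + 1] columns; on its left and past its
    end the code is 0, that of the blank. *)
Definition start_code j := if j < N then 0 else inp_code x (j - N).

Definition cell_ok i j g :=
  [&& valid S g, (j == 0) ==> first_col S g, (j.+1 == W) ==> last_col S g,
      (i.+1 == N) ==> last_row S g
    & (i == 0) ==> first_row S (start_code j) (j == N) g].

Definition tiling (f : nat -> nat -> nat) : Prop :=
  [/\ forall i j, i < N -> j < W -> f i j < K /\ cell_ok i j (f i j),
      forall i j, i < N -> j.+1 < W -> hrel S (f i j) (f i j.+1)
    & forall i j, i.+1 < N -> j < W -> vrel S (f i j) (f i.+1 j)].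

Definition nclauses := N * W * 4 * K * K.
Definition nvars := N * W * K.

(** The variable [c * K + g] puts the tile [g] in the cell [c]. The types 0, 1 and 2 exclude a tile
    from its cell, a horizontal pair and a vertical pair; for type 0 [second] repeats the first
    variable. *)
Definition forbidden c ty g g' : bool :=
  if ty == 0 then ~~ cell_ok (c %/ W) (c %% W) g
  else if ty == 1 then (c %% W + 1 < W) && ~~ hrel S g g'
  else if ty == 2 then (c + W < N * W) && ~~ vrel S g g'
  else false.

Definition second c ty g g' : nat :=
  if ty == 0 then c * K + g else if ty == 1 then (c + 1) * K + g'
  else (c + W) * K + g'.

(** The index [m] encodes [(c, ty, g, g')]. A clause with nothing to forbid says instead that the
    cell [c] has a tile, the boolean being coerced to the code 1 of a positive occurrence. *)
Definition tile_inc m v : nat :=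
  let g' := m %% K in
  let g := m %/ K %% K in
  let ty := m %/ K %/ K %% 4 in
  let c := m %/ K %/ K %/ 4 in
  if forbidden c ty g g' then
    if (v == c * K + g) || (v == second c ty g g') then 2 else 0
  else v %/ K == c.

Hypotheses (K_gt0 : 0 < K) (N_gt0 : 0 < N).

Let W_gt0 : 0 < W. Proof. by rewrite /W; lia. Qed.

Lemma tile_incE c ty g g' v : ty < 4 -> g < K -> g' < K ->
  tile_inc (((c * 4 + ty) * K + g) * K + g') v =
  if forbidden c ty g g' then
    if (v == c * K + g) || (v == second c ty g g') then 2 else 0
  else v %/ K == c.
Proof.
move=> ty4 gK g'K; rewrite /tile_inc.
rewrite modnMDl divnMDl // (divn_small g'K) (modn_small g'K) addn0.
rewrite modnMDl divnMDl // (divn_small gK) (modn_small gK) addn0.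
by rewrite modnMDl divnMDl // (divn_small ty4) (modn_small ty4) addn0.
Qed.

Lemma clause_lt c ty g g' : c < N * W -> ty < 4 -> g < K -> g' < K ->
  ((c * 4 + ty) * K + g) * K + g' < nclauses.
Proof.
move=> cN ty4 gK g'K; rewrite /nclauses.
have step a b n m : a < n -> b < m -> a * m + b < n * m.
  by move=> an bm; apply: leq_trans (_ : a.+1 * m <= _); [rewrite mulSn; lia|rewrite leq_mul2r an orbT].
by do 3!apply: (step) => //.
Qed.

Lemma var_lt c g : c < N * W -> g < K -> c * K + g < nvars.
Proof.
move=> cN gK; rewrite /nvars; apply: leq_trans (_ : c.+1 * K <= _).
  by rewrite mulSn; lia.
by rewrite leq_mul2r cN orbT.
Qed.

Lemma cell_lt i j : i < N -> j < W -> i * W + j < N * W.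
Proof.
move=> iN jW; apply: leq_trans (_ : i.+1 * W <= _); first by rewrite mulSn; lia.
by rewrite leq_mul2r iN orbT.
Qed.

(** Tiles and pairs are only forbidden, so when an assignment marks several tiles in a cell, any of
    them can be kept; the first one is. *)
Lemma tiling_satisfiable :
  (exists f, tiling f) <-> satisfiable nclauses nvars tile_inc.
Proof.
split.
  move=> [f [f1 f2 f3]].
  pose F c := f (c %/ W) (c %% W).
  have FK c : c < N * W -> F c < K.
    by move=> cN; apply: (f1 _ _ _ _).1; rewrite ?ltn_mod // ltn_divLR.
  exists (fun v => F (v %/ K) == v %% K) => m mM.
  have g'K : m %% K < K by rewrite ltn_mod.
  have gK : m %/ K %% K < K by rewrite ltn_mod.
  have ty4 : m %/ K %/ K %% 4 < 4 by rewrite ltn_mod.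
  have cN : m %/ K %/ K %/ 4 < N * W.
    by rewrite !ltn_divLR //; rewrite /nclauses in mM; lia.
  rewrite (divn_eq m K) (divn_eq (m %/ K) K) (divn_eq (m %/ K %/ K) 4).
  move: (m %% K) (m %/ K %% K) (m %/ K %/ K %% 4) (m %/ K %/ K %/ 4) g'K gK ty4 cN.
  move=> g' g ty c g'K gK ty4 cN {m mM}; rewrite /literal.
  have dK e h : h < K -> (e * K + h) %/ K = e /\ (e * K + h) %% K = h.
    by move=> hK; rewrite divnMDl // modnMDl divn_small // modn_small // addn0.
  case fb: (forbidden c ty g g'); last first.
    exists (c * K + F c); first by rewrite var_lt ?FK.
    by rewrite tile_incE // fb; have [-> ->] := dK c (F c) (FK c cN); rewrite !eqxx.
  have [Fg|Fg] := eqVneq (F c) g; last first.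
    exists (c * K + g); first by rewrite var_lt.
    by rewrite tile_incE // fb eqxx /=; have [-> ->] := dK c g gK.
  have second_lit e : e < N * W -> second c ty g g' = e * K + g' -> F e != g' ->
      exists2 v, v < nvars &
      (tile_inc (((c * 4 + ty) * K + g) * K + g') v == 1) && (F (v %/ K) == v %% K) ||
      (tile_inc (((c * 4 + ty) * K + g) * K + g') v == 2) && (F (v %/ K) != v %% K).
    move=> eN se Fe; exists (e * K + g'); first by rewrite var_lt.
    by rewrite tile_incE // fb se eqxx orbT /=; have [-> ->] := dK e g' g'K.
  have iN : c %/ W < N by rewrite ltn_divLR.
  have jW : c %% W < W by rewrite ltn_mod.
  move: fb second_lit; rewrite /forbidden /second.
  case: ifP => _; first by rewrite -Fg (f1 _ _ iN jW).2.
  case: ifP => _.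
    move=> /andP[j1 nh] H; apply: (H (c + 1)) => //.
      by rewrite (divn_eq c W) -addnA cell_lt.
    apply: contraNneq nh => <-; rewrite -Fg /F.
    have -> : (c + 1) %/ W = c %/ W.
      by rewrite {1}(divn_eq c W) -addnA divnMDl // (divn_small j1) addn0.
    have -> : (c + 1) %% W = (c %% W).+1.
      by rewrite {1}(divn_eq c W) -addnA modnMDl modn_small // addn1.
    by apply: f2 => //; rewrite -addn1.
  case: ifP => // _ /andP[j1 nh] H; apply: (H (c + W)) => //.
  have cW : (c + W) %/ W = (c %/ W).+1 by rewrite divnDr // divnn W_gt0 addn1.
  apply: contraNneq nh => <-; rewrite -Fg /F modnDr cW.
  by apply: f3 => //; rewrite -cW ltn_divLR.
move=> [a Ha].
have tile_of c : c < N * W -> exists2 g, g < K & a (c * K + g).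
  (* Type 3 forbids nothing, so its clause provides a tile for the cell. *)
  move=> cN; have [v vV] := Ha _ (clause_lt cN (isT : 3 < 4) K_gt0 K_gt0).
  rewrite /literal tile_incE //= eqb1 => /orP[/andP[/eqP <- av]|/andP[]].
    by exists (v %% K); rewrite ?ltn_mod // -divn_eq.
  by case: (_ == c).
pose F c := find (fun g => a (c * K + g)) (iota 0 K).
have FP c : c < N * W -> F c < K /\ a (c * K + F c).
  move=> /tile_of[g gK ag].
  have hz : has (fun g => a (c * K + g)) (iota 0 K).
    by apply/hasP; exists g => //; rewrite mem_iota.
  have := nth_find 0 hz; move: hz; rewrite has_find size_iota => hz.
  by rewrite nth_iota.
have noforb c ty g g' : c < N * W -> ty < 4 -> g < K -> g' < K ->
    a (c * K + g) -> a (second c ty g g') -> forbidden c ty g g' = false.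
  move=> cN ty4 gK g'K a1 a2; apply/negP => fb.
  have [v vV] := Ha _ (clause_lt cN ty4 gK g'K).
  rewrite /literal tile_incE // fb; case: ifP => //= /orP[]/eqP->.
    by rewrite a1.
  by rewrite a2.
exists (fun i j => F (i * W + j)).
have dW i j : j < W -> (i * W + j) %/ W = i /\ (i * W + j) %% W = j.
  by move=> jW; rewrite divnMDl // modnMDl divn_small // modn_small // addn0.
split.
- move=> i j iN jW; have [FK aF] := FP _ (cell_lt iN jW); split=> //.
  have := noforb (i * W + j) 0 _ 0 (cell_lt iN jW) isT FK K_gt0 aF aF.
  by rewrite /forbidden /=; have [-> ->] := dW i j jW; move/negbFE.
- move=> i j iN jW; have jW' := ltnW jW; have [FK aF] := FP _ (cell_lt iN jW').
  have [FK' aF'] := FP _ (cell_lt iN jW).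
  have := noforb (i * W + j) 1 _ _ (cell_lt iN jW') isT FK FK' aF.
  rewrite /second /= -addnA addn1 => /(_ aF'); rewrite /forbidden /=.
  by have [_ ->] := dW i j jW'; rewrite addn1 jW => /negbFE.
- move=> i j iN jW; have iN' := ltnW iN; have [FK aF] := FP _ (cell_lt iN' jW).
  have [FK' aF'] := FP _ (cell_lt iN jW).
  have := noforb (i * W + j) 2 _ _ (cell_lt iN' jW) isT FK FK' aF.
  have e : i * W + j + W = i.+1 * W + j by rewrite mulSn; lia.
  rewrite /second /= e => /(_ aF'); rewrite /forbidden /= e.
  by rewrite cell_lt // => /negbFE.
Qed.

End Tiling.

(** * Expressions for the clauses of a tiling *)

Section TilingExpr.
Variables (S : tileset) (N : seq bool -> nat) (eN : expr).
Hypothesis eNP : forall x u v, eval x u v eN = N x.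
Hypotheses (S_gt0 : 0 < ntiles S) (N_gt0 : forall x, 0 < N x).
Let K := ntiles S.

Definition EImp a b := EAdd (ENot a) b.
Definition eW := ESucc (EMul (EConst 2) eN).
Definition estart j := EIf (ELt j eN) (EConst 0) (EInp (ESub j eN)).

(** The bound 3 of the tables for the first row is due to the start codes, which are 0, 1 or 2. *)
Definition ecell_ok i j g :=
  let tab P := ETab K P g in
  EMul (tab (valid S))
  (EMul (EImp (EEq j (EConst 0)) (tab (first_col S)))
  (EMul (EImp (EEq (ESucc j) eW) (tab (last_col S)))
  (EMul (EImp (EEq (ESucc i) eN) (tab (last_row S)))
    (EImp (EEq i (EConst 0))
       (EIf (EEq j eN) (ETab2 3 K (fun c => first_row S c true) (estart j) g)
          (ETab2 3 K (fun c => first_row S c false) (estart j) g)))))).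

Definition etile_inc m v :=
  let cK := EConst K in
  let g' := EModn m cK in
  let g := EModn (EDivn m cK) cK in
  let q := EDivn (EDivn m cK) cK in
  let ty := EModn q (EConst 4) in
  let c := EDivn q (EConst 4) in
  let tyis i a b := EIf (EEq ty (EConst i)) a b in
  let forb :=
    tyis 0 (ENot (ecell_ok (EDivn c eW) (EModn c eW) g))
      (tyis 1 (EMul (ELt (EAdd (EModn c eW) (EConst 1)) eW)
                 (ENot (ETab2 K K (hrel S) g g')))
        (tyis 2 (EMul (ELt (EAdd c eW) (EMul eN eW)) (ENot (ETab2 K K (vrel S) g g')))
          (EConst 0))) in
  let sec :=
    tyis 0 (EAdd (EMul c cK) g)
      (tyis 1 (EAdd (EMul (EAdd c (EConst 1)) cK) g') (EAdd (EMul (EAdd c eW) cK) g')) in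
  EIf forb
    (EIf (EAdd (EEq v (EAdd (EMul c cK) g)) (EEq v sec)) (EConst 2) (EConst 0))
    (EEq (EDivn v cK) c).

Lemma truth_if x u v c a b :
  truth x u v (EIf c a b) = if truth x u v c then truth x u v a else truth x u v b.
Proof. by rewrite {1}/truth eval_if; case: (truth x u v c). Qed.

Lemma eval_etile_inc x u v a b :
  eval x u v (etile_inc a b) = tile_inc S x (N x) (eval x u v a) (eval x u v b).
Proof.
have cst c : eval x u v (EConst c) = c by [].
have add f g : eval x u v (EAdd f g) = eval x u v f + eval x u v g by [].
have mul f g : eval x u v (EMul f g) = eval x u v f * eval x u v g by [].
have eWE : eval x u v eW = 2 * N x + 1 by rewrite eval_succ mul eNP cst addn1.
have W0 : 0 < eval x u v eW by rewrite eWE addn1.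
have W0' : 0 < 2 * N x + 1 by rewrite addn1.
have K0 : 0 < eval x u v (EConst K) by [].
have cellP i j g : eval x u v g < K ->
    truth x u v (ecell_ok i j g) =
    cell_ok S x (N x) (eval x u v i) (eval x u v j) (eval x u v g).
  move=> gK; have st : eval x u v (estart j) = start_code x (N x) (eval x u v j).
    by rewrite eval_if truth_lt eNP /start_code; case: ifP => //= _; rewrite eNP.
  have st3 : eval x u v (estart j) < 3.
    by rewrite st /start_code /inp_code; case: ifP => // _; case: (drop _ _) => [|[]].
  have tab h := truth_tab2 (fun c => first_row S c h) st3 gK.
  rewrite /ecell_ok /cell_ok !(truth_if, tab, truthE).
  rewrite !truth_tab // st eWE eNP !evalE cst -!implybE addn1.
  by case: (eval x u v j == N x).
rewrite /etile_inc /tile_inc.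
set g' := EModn a _; set g := EModn (EDivn a _) _; set q := EDivn (EDivn _ _) _.
set ty := EModn q _; set c := EDivn q _.
have g'E : eval x u v g' = eval x u v a %% K by rewrite eval_modn.
have gE : eval x u v g = eval x u v a %/ K %% K by rewrite eval_modn // eval_divn.
have qE : eval x u v q = eval x u v a %/ K %/ K by rewrite !eval_divn.
have tyE : eval x u v ty = eval x u v a %/ K %/ K %% 4 by rewrite eval_modn // qE.
have cE : eval x u v c = eval x u v a %/ K %/ K %/ 4 by rewrite eval_divn // qE.
have gK : eval x u v g < K by rewrite gE ltn_mod.
have g'K : eval x u v g' < K by rewrite g'E ltn_mod.
have cg i j := cellP i j g gK.
clearbody ty c g g'.
rewrite !(eval_if, truth_if, cg, truthE, eval_eq) !truth_tab2 //.
rewrite !(eWE, eval_divn, eval_modn, add, mul) //.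
rewrite !eNP !cst !cE !gE !g'E tyE.
rewrite /forbidden /second.
by [].
Qed.

Lemma tiling_NP_hard (L : seq bool -> Prop) :
  (forall x, L x <-> exists f, tiling S x (N x) f) ->
  poly_reducible L restricted_TDS.
Proof.
move=> HL.
pose eV := EMul (EMul eN eW) (EConst K).
pose eM := EMul (EMul (EMul (EMul eN eW) (EConst 4)) (EConst K)) (EConst K).
apply: (@reduction_NP_hard (fun x => nclauses S (N x)) (fun x => nvars S (N x))
  (fun x => tile_inc S x (N x)) eM eV etile_inc).
- by move=> x u v; rewrite /= !eNP.
- by move=> x u v; rewrite /= !eNP.
- by move=> x u v a b; exact: eval_etile_inc.
- by move=> x; rewrite /nclauses !muln_gt0 N_gt0 S_gt0 addn1.
- by move=> x; rewrite /nvars !muln_gt0 N_gt0 S_gt0 addn1.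
- by move=> x; rewrite HL; exact: tiling_satisfiable.
Qed.

End TilingExpr.

(** * Space-time diagrams as tilings *)

(* Position of a cell [j] relative to the head position [p]: 0 far left, 1 just
   left, 2 under the head, 3 just right, 4 far right. With these five values
   the horizontal and vertical rules below only relate adjacent cells. *)
Definition mark p j : nat :=
  if j.+1 < p then 0 else if j.+1 == p then 1 else if j == p then 2
  else if j == p.+1 then 3 else 4.

Definition mark_next (a b : nat) : bool :=
  (a, b) \in [:: (0, 0); (0, 1); (1, 2); (2, 3); (3, 4); (4, 4)].

Lemma mark_lt5 p j : mark p j < 5.
Proof. by rewrite /mark; do !case: ifP. Qed.

Lemma mark_nextP p j : mark_next (mark p j) (mark p j.+1).
Proof. by rewrite /mark; do !case: ifP => //; lia. Qed.

Lemma mark2 p j : mark p j = 2 -> j = p.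
Proof. by rewrite /mark; do !case: ifP => //; lia. Qed.

Lemma mark_id p : mark p p = 2.
Proof. by rewrite /mark; do !case: ifP => //; lia. Qed.

(** The allowed successions run through 0...0 1 2 3 4...4. As the row starts at most at 2 and ends
    at least at 2, its first value above 1 is a 2, from which the marks on both sides are forced. *)
Lemma mark_exists (mu : nat -> nat) W : 0 < W -> mu 0 <= 2 -> 2 <= mu W.-1 ->
  (forall j, j.+1 < W -> mark_next (mu j) (mu j.+1)) ->
  exists2 p, p < W & forall j, j < W -> mu j = mark p j.
Proof.
move=> W0 m0 mW mn.
have step j : j.+1 < W ->
    mu j = 0 /\ mu j.+1 = 0 \/ mu j = 0 /\ mu j.+1 = 1 \/ mu j = 1 /\ mu j.+1 = 2 \/
    mu j = 2 /\ mu j.+1 = 3 \/ mu j = 3 /\ mu j.+1 = 4 \/ mu j = 4 /\ mu j.+1 = 4.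
  move=> jW; have := mn j jW; rewrite /mark_next !inE !xpair_eqE.
  by case/or4P=> [|||/or3P[]] /andP[/eqP-> /eqP->]; tauto.
have [p pW mp] : exists2 p, p < W & mu p = 2.
  have e : exists p, 2 <= mu p by exists W.-1.
  have [p mp min] := ex_minnP e.
  have pW : p < W by have := min _ mW; lia.
  exists p => //; case: p mp min pW => [|p] mp min pW; first by lia.
  have : mu p < 2 by rewrite ltnNge; apply/negP => /min; lia.
  by have := step p pW; lia.
exists p => // j jW.
have [pj|jp] := leqP p j.
  elim: j jW pj => [|j IH] jW pj; first by rewrite (_ : p = 0) ?mark_id -?mp; [congr mu|]; lia.
  have [e|pj'] := eqVneq p j.+1; first by rewrite -e mark_id.
  have := IH (ltnW jW) ltac:(lia); have := step j jW.
  by rewrite /mark; do !case: ifP; lia.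
have [d] := ubnP (p - j); elim: d j jW jp => // d IH j jW jp dd.
have [e|pj'] := eqVneq j.+1 p.
  by have := step j ltac:(lia); rewrite /mark e; do !case: ifP; lia.
have := IH j.+1 ltac:(lia) ltac:(lia) ltac:(lia); have := step j ltac:(lia).
by rewrite /mark; do !case: ifP; lia.
Qed.

(** * Tape contents in absolute coordinates *)

Section Cells.
Variable A : finType.

Definition cell (t : tape A) p j : symbol A :=
  if j < p then nth None t.1 (p - j.+1) else nth None t.2 (j - p).

Definition shift p mv : nat :=
  match mv with MoveLeft => p.-1 | Stay => p | MoveRight => p.+1 end.

(** After the move, this is the mark of the column that the head has left: after a left move it lies
    just right of the head. *)
Definition shift_mark mv : nat :=
  match mv with MoveLeft => 3 | Stay => 2 | MoveRight => 1 end.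

Lemma shift_markP p mv : 0 < p -> mark (shift p mv) p = shift_mark mv.
Proof. by case: mv => /= p0; rewrite /mark; do !case: ifP => //; lia. Qed.

Lemma mark_shift p p' mv : mark p' p = shift_mark mv -> p' = shift p mv.
Proof. by case: mv => /=; rewrite /mark; do !case: ifP => //; lia. Qed.

Lemma shift_left_gt0 p p' : mark p' p = shift_mark MoveLeft -> 0 < p.
Proof. by rewrite /= /mark; do !case: ifP => //; lia. Qed.

Lemma cell_head t p : cell t p p = read t.
Proof. by rewrite /cell ltnn subnn nth0. Qed.

(** In absolute coordinates only the old head column changes. A left move from column 0 has no
    target among the natural numbers, hence the side condition. *)
Lemma cell_write t p a j : (a.2 = MoveLeft -> 0 < p) ->
  cell (write_move t a) (shift p a.2) j = if j == p then a.1 else cell t p j.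
Proof.
case: t a => l r [s mv] /= Hp; rewrite /cell /write_move /=.
have nb (w : seq (symbol A)) i : nth None (behead w) i = nth None w i.+1.
  by rewrite nth_behead.
case: mv Hp => /= Hp.
- have {}Hp := Hp erefl; case: (ltngtP j p) => [jp|pj|->].
  + case: ltnP => j1; first by rewrite nb; congr nth; lia.
    have -> : j = p.-1 by lia.
    by rewrite subnn /= (_ : p - p.-1.+1 = 0) ?nth0 //; lia.
  + rewrite ltnNge (_ : p.-1 <= j) /=; last by lia.
    by rewrite (_ : j - p.-1 = (j - p.+1).+2) /= ?nb; [congr nth|]; lia.
  + rewrite ltnNge (_ : p.-1 <= p) /=; last by lia.
    by rewrite (_ : p - p.-1 = 1) //; lia.
- case: (ltngtP j p) => [jp|pj|->] //; last by rewrite subnn.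
  by rewrite (_ : j - p = (j - p.+1).+1) /= ?nb //; lia.
- case: (ltngtP j p) => [jp|pj|->].
  + by rewrite ltnS (ltnW jp) (_ : p.+1 - j.+1 = (p - j.+1).+1) //; lia.
  + by rewrite ltnNge pj /= nb; congr nth; lia.
  + by rewrite ltnSn subnn.
Qed.

End Cells.

Lemma nth_map_some_mem (B : Type) (l : seq B) i a (T : eqType) (f : B -> T) :
  nth None [seq Some b | b <- l] i = Some a -> f a \in [seq f b | b <- l].
Proof.
elim: l i => [|b l IH] [|i] //=; first by case=> ->; rewrite mem_head.
by move/IH => H; rewrite inE H orbT.
Qed.

Lemma nth_map_some_index (B : Type) (l : seq B) (T : eqType) (f : B -> T) y :
  y \in [seq f b | b <- l] -> exists2 a,
    nth None [seq Some b | b <- l] (index y [seq f b | b <- l]) = Some a & f a = y.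
Proof.
elim: l => //= b l IH; rewrite inE eq_sym; case: eqP => [<- _|_ /=]; first by exists b.
exact: IH.
Qed.

Lemma poly_nat_bound (p : {poly nat}) : exists c, forall n : nat, (p.[n])%R <= (n + 2) ^ c.
Proof.
elim/poly_ind: p => [|p a [c IH]]; first by exists 0 => n; rewrite horner0.
exists (c + 1 + (a + 1)) => n; rewrite hornerD hornerMX hornerC.
have H1 : (p.[n])%R * n <= (n + 2) ^ (c + 1).
  by rewrite expnD leq_mul // expn1; lia.
have H2 : a + 1 < (n + 2) ^ (a + 1).
  by apply: leq_trans (ltn_expl (a + 1) (isT : 1 < 2)) _; rewrite leq_exp2r; lia.
have H3 : 0 < (n + 2) ^ (c + 1) by rewrite expn_gt0; lia.
rewrite expnD; change (((p.[n])%R * n)%N + a <= (n + 2) ^ (c + 1) * (n + 2) ^ (a + 1)).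
nia.
Qed.

(** * The tiles of a nondeterministic machine *)

Section Diagram.
Variable M : machine.
Notation k := (extra_tapes M).
Notation sy := (option (bool + aux M)).

(** The successor keeps the type of choices inhabited when no action exists, and leaves room for an
    index equal to the length of the list of actions. *)
Definition branching :=
  (\max_(z : state M * {ffun 'I_k.+1 -> sy}) size (@trans M z.1 z.2)).+1.

(* A tile records the state, the symbols read and the index of the chosen action
   (all three constant along a row) and, for each tape, the symbol of the cell and
   its position relative to the head. *)
Definition tile : finType :=
  (state M * {ffun 'I_k.+1 -> sy} * 'I_branching * {ffun 'I_k.+1 -> sy * 'I_5})%type.

Definition tstate (g : tile) : state M := g.1.1.1.
Definition treads (g : tile) : {ffun 'I_k.+1 -> sy} := g.1.1.2.
Definition tchoice (g : tile) : 'I_branching := g.1.2.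
Definition tsym (g : tile) i : sy := (g.2 i).1.
Definition tmark (g : tile) i : 'I_5 := (g.2 i).2.

Definition tmoves (g : tile) := @trans M (tstate g) (treads g).
Definition taction (g : tile) := nth None [seq Some a | a <- tmoves g] (tchoice g).

(** An out-of-range choice is tolerated only in a halting row; otherwise a tiling could stall before
    the machine halts. *)
Definition tile_valid (g : tile) :=
  ((tchoice g < size (tmoves g)) || nilp (tmoves g)) &&
  [forall i, (tmark g i == 2 :> nat) ==> (tsym g i == treads g i)].

Definition tile_h (g g' : tile) :=
  [&& tstate g == tstate g', treads g == treads g', tchoice g == tchoice g'
    & [forall i, mark_next (tmark g i) (tmark g' i)]].

(** When an action is applied, the new mark is fixed only in the old head column; the horizontal
    rule determines it elsewhere. A row without action is repeated. *)
Definition tile_v (g g' : tile) :=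
  if taction g is Some a then
    (tstate g' == a.1) &&
    [forall i, if tmark g i == 2 :> nat then
       (tsym g' i == (a.2 i).1) && (tmark g' i == shift_mark (a.2 i).2 :> nat)
     else tsym g' i == tsym g i]
  else (tstate g' == tstate g) &&
    [forall i, (tsym g' i == tsym g i) && (tmark g' i == tmark g i)].

Definition code_sym c : sy :=
  match c with 0 => None | 1 => Some (inl false) | _ => Some (inl true) end.

Definition tile_first c h (g : tile) :=
  (tstate g == start M) &&
  [forall i, ((tmark g i == 2 :> nat) == h) &&
             (tsym g i == if i == ord0 then code_sym c else None)].

Definition tile0 : tile := (start M, [ffun=> None], ord0, [ffun=> (None, ord0)]).
Definition tile_of n : tile := nth tile0 (enum tile) n.

(** The border conditions on the marks are those of [mark_exists]: they guarantee one head per tape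
    in each row. *)
Definition machine_tiles : tileset := @Tileset #|tile|
  (fun a b => tile_h (tile_of a) (tile_of b))
  (fun a b => tile_v (tile_of a) (tile_of b))
  (fun a => tile_valid (tile_of a))
  (fun a => [forall i, tmark (tile_of a) i <= 2])
  (fun a => [forall i, 2 <= tmark (tile_of a) i])
  (fun a => nilp (tmoves (tile_of a)) && accepting (tstate (tile_of a)))
  (fun c h a => tile_first c h (tile_of a)).

Lemma code_symP x N j : code_sym (start_code x N j) =
  if j < N then None else nth None (word (aux M) x) (j - N).
Proof.
rewrite /start_code; case: ifP => // _; rewrite /inp_code.
by elim: x (j - N) => [|b x IH] [|n] //=; case: b.
Qed.

(** * Reading an accepting computation off a tiling *)

Section Sound.
Variables (x : seq bool) (N : nat) (f : nat -> nat -> nat).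
Hypothesis N_gt0 : 0 < N.
Hypothesis fP : tiling machine_tiles x N f.
Let W := 2 * N + 1.
Let F i j := tile_of (f i j).

Let F_const i j : i < N -> j < W ->
  [/\ tstate (F i j) = tstate (F i 0), treads (F i j) = treads (F i 0)
    & tchoice (F i j) = tchoice (F i 0)].
Proof.
have [_ fh _] := fP; move=> iN; elim: j => // j IH jW.
have [<- <- <-] := IH (ltnW jW).
by have /and4P[/eqP-> /eqP-> /eqP-> _] := fh i j iN jW.
Qed.

Let F_mark i t : i < N ->
  exists2 p, p < W & forall j, j < W -> tmark (F i j) t = mark p j :> nat.
Proof.
have [f1 fh _] := fP; move=> iN.
have W0 : 0 < W by rewrite /W addn1.
apply: (@mark_exists (fun j => tmark (F i j) t)) => // [||j jW].
- have [_ /and5P[_ /implyP/(_ (eqxx 0)) /forallP H _ _ _]] := f1 i 0 iN W0.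
  exact: H.
- have [_ /and5P[_ _ /implyP H _ _]] := f1 i W.-1 iN ltac:(lia).
  by have /forallP := H ltac:(by rewrite prednK).
- by have /and4P[_ _ _ /forallP H] := fh i j iN jW; exact: H.
Qed.

Let represents i (c : config M) :=
  c.1 = tstate (F i 0) /\
  forall t, exists p, [/\ p < W,
    forall j, j < W -> tsym (F i j) t = cell (c.2 t) p j
    & forall j, j < W -> tmark (F i j) t = mark p j :> nat].

Let represents_reads i c : i < N -> represents i c ->
  [ffun t => read (c.2 t)] = treads (F i 0).
Proof.
have [f1 _ _] := fP; move=> iN [_ H]; apply/ffunP => t; rewrite ffunE.
have [p [pW Hs Hm]] := H t.
have : tile_valid (F i p) by have [_ /and5P[]] := f1 i p iN pW.
move=> /andP[_ /forallP/(_ t)]; rewrite Hm // mark_id eqxx /= => /eqP.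
by rewrite Hs // cell_head => ->; have [_ ->] := F_const iN pW.
Qed.

Let represents0 : represents 0 (init M x).
Proof.
have [f1 _ _] := fP.
have H j : j < W -> tile_first (start_code x N j) (j == N) (F 0 j).
  move=> jW; have [_ /and5P[_ _ _ _ /implyP]] := f1 0 j N_gt0 jW; exact.
have NW : N < W by rewrite /W; lia.
have W0 : 0 < W by lia.
split; first by have /andP[/eqP-> _] := H 0 W0.
move=> t; have [p pW Hm] := F_mark t N_gt0.
have /andP[_ /forallP/(_ t)/andP[]] := H N NW.
rewrite Hm // eqxx => /eqP/eqP/mark2 e _.
exists p; split=> //.
move=> j jW; have /andP[_ /forallP/(_ t)/andP[_ /eqP->]] := H j jW.
rewrite ffunE /cell -e /= nth_nil.
by case: (t == ord0); rewrite ?code_symP ?nth_nil //; case: ifP.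
Qed.

(** State, symbols read and choice are constant along a row, so all columns apply the same action; a
    row without action adds no step. *)
Let representsS i c : i.+1 < N -> represents i c ->
  represents i.+1 c \/ exists2 c', represents i.+1 c' & step c c'.
Proof.
have [f1 _ fv] := fP; move=> iN Hc; have iN' := ltnW iN.
have rdE := represents_reads iN' Hc; have [cq H] := Hc.
have W0 : 0 < W by rewrite /W; lia.
have vE j : j < W -> tile_v (F i j) (F i.+1 j) by move=> jW; exact: fv.
have actE j : j < W -> taction (F i j) = taction (F i 0).
  by move=> jW; rewrite /taction /tmoves; have [-> -> ->] := F_const iN' jW.
case E: (taction (F i 0)) => [a|]; last first.
  left; split.
    by have := vE 0 W0; rewrite /tile_v E => /andP[/eqP-> _].
  move=> t; have [p [pW Hs Hm]] := H t; exists p; split=> // j jW;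
    have := vE j jW; rewrite /tile_v actE // E => /andP[_ /forallP/(_ t)/andP[/eqP e1 /eqP e2]].
    by rewrite e1 Hs.
  by rewrite e2 Hm.
right; exists (a.1, [ffun t => write_move (c.2 t) ((a.2 : {ffun _ -> _}) t)]); last first.
  rewrite /step /successors rdE cq.
  exact: (nth_map_some_mem (fun a => (a.1, [ffun t => write_move (c.2 t) ((a.2 : {ffun _ -> _}) t)])) E).
split; first by have := vE 0 W0; rewrite /tile_v E => /andP[/eqP-> _].
move=> t; have [p [pW Hs Hm]] := H t; have [p' p'W Hm'] := F_mark t iN.
(* The rule in the old head column gives its mark in the next row, and thereby the new head
   position. *)
have := vE p pW; rewrite /tile_v actE // E => /andP[_ /forallP/(_ t)].
rewrite Hm // mark_id eqxx Hm' // => /andP[/eqP sp /eqP mp].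
exists p'; split=> // j jW; rewrite ffunE /= (mark_shift mp) cell_write; last first.
  by move=> e; apply: (@shift_left_gt0 p p'); rewrite mp e.
have [->|jp] := eqVneq j p; first exact: sp.
have := vE j jW; rewrite /tile_v actE // E => /andP[_ /forallP/(_ t)].
rewrite Hm //; case: eqP => [/mark2 e|_ /eqP-> //]; first by rewrite e eqxx in jp.
exact: Hs.
Qed.

Lemma tiling_accepts : accepts M x.
Proof.
have run i : i < N -> exists2 s, computation x s & represents i (last (init M x) s).
  elim: i => [|i IH] iN; first by exists [::].
  have [s Hs Hr] := IH (ltnW iN).
  have [Hr'|[c Hc st]] := representsS iN Hr; first by exists s.
  exists (rcons s c); last by rewrite last_rcons.
  by rewrite /computation rcons_path; apply/andP; split.
have lN : N.-1 < N by lia.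
have [s Hs Hr] := run _ lN; have [cq _] := Hr.
have [f1 _ _] := fP.
have [_ /and5P[_ _ _ /implyP H _]] := f1 N.-1 0 lN ltac:(rewrite addn1; lia).
have {H} /andP[Hn Ha] : nilp (tmoves (F N.-1 0)) && accepting (tstate (F N.-1 0)).
  by apply: H; rewrite prednK.
exists s; split=> //; last by rewrite cq.
by rewrite /halted /successors (represents_reads lN Hr) cq /nilp size_map.
Qed.

End Sound.

(** * Drawing the tiling of an accepting computation *)

Section Complete.
Variables (x : seq bool) (N : nat) (s : seq (config M)).
Hypothesis s_comp : computation x s.
Hypothesis s_halt : halted (last (init M x) s).
Hypothesis s_acc : accepting (last (init M x) s).1.
Hypothesis s_lt : size s < N.

(** Past the end of [s] the default value repeats the final configuration, which fills the remaining
    rows. *)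
Let conf i : config M := nth (last (init M x) s) (init M x :: s) i.
Let rds i : {ffun 'I_k.+1 -> sy} := [ffun t => read ((conf i).2 t)].
(** The position of the next configuration among the successors is the position of an action
    producing it. *)
Let idx i : 'I_branching := inord (index (conf i.+1) (successors (conf i))).
Let act i := nth None [seq Some a | a <- @trans M (conf i).1 (rds i)] (idx i).

(** Starting in column [N], the head stays off the borders in all the rows below [N], so no left
    move starts from column 0. *)
Fixpoint head_pos i t : nat :=
  if i is i'.+1 then
    if act i' is Some a then shift (head_pos i' t) (a.2 t).2 else head_pos i' t
  else N.

Let diagram i j : tile :=
  ((conf i).1, rds i, idx i,
   [ffun t => (cell ((conf i).2 t) (head_pos i t) j, inord (mark (head_pos i t) j))]).

Let conf_last i : size s <= i -> conf i = last (init M x) s.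
Proof.
rewrite leq_eqVlt => /orP[/eqP<-|si]; first by rewrite /conf -last_nth.
by rewrite /conf nth_default.
Qed.

Let act_some i : i < size s -> exists a, [/\ act i = Some a,
  conf i.+1 = (a.1, [ffun t => write_move ((conf i).2 t) ((a.2 : {ffun _ -> _}) t)])
  & idx i < size (@trans M (conf i).1 (rds i))].
Proof.
move=> si; have st : step (conf i) (conf i.+1).
  by have /(pathP (last (init M x) s)) := s_comp; apply.
have idxE : idx i = index (conf i.+1) (successors (conf i)) :> nat.
  rewrite inordK // ltnS; apply: leq_trans (index_size _ _) _; rewrite size_map.
  exact: (@leq_bigmax _ (fun z : state M * {ffun 'I_k.+1 -> sy} => size (@trans M z.1 z.2))
    ((conf i).1, rds i)).
have [a Ha Ea] := nth_map_some_index st.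
exists a; split=> //; first by rewrite /act idxE.
by rewrite idxE -(size_map (fun a => (a.1, [ffun t => write_move ((conf i).2 t)
  ((a.2 : {ffun _ -> _}) t)]))) index_mem.
Qed.

Let trans_nil i : size s <= i -> @trans M (conf i).1 (rds i) = [::].
Proof.
move=> si; have := s_halt; rewrite -(conf_last si) /halted /successors /nilp size_map.
by move/nilP.
Qed.

Let act_none i : size s <= i -> act i = None /\ conf i.+1 = conf i.
Proof.
move=> si; rewrite /act trans_nil // nth_nil; split=> //.
by rewrite !conf_last //; lia.
Qed.

Let head_pos_bound i t : i < N -> N - i <= head_pos i t <= N + i.
Proof.
elim: i => [|i IH] iN /=; first by lia.
have := IH (ltnW iN); case: (act i) => [a|]; last by lia.
by rewrite /shift; case: (a.2 t).2; lia.
Qed.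

Let diagram_mark i j t : tmark (diagram i j) t = mark (head_pos i t) j :> nat.
Proof. by rewrite /tmark /= ffunE /= inordK // mark_lt5. Qed.

Let diagram_sym i j t : tsym (diagram i j) t = cell ((conf i).2 t) (head_pos i t) j.
Proof. by rewrite /tsym /= ffunE. Qed.

Let diagram_action i j : taction (diagram i j) = act i.
Proof. by []. Qed.

Let tile_ofK g : tile_of (enum_rank g) = g.
Proof. exact: nth_enum_rank. Qed.

Lemma accepts_tiling : exists f, tiling machine_tiles x N f.
Proof.
exists (fun i j => enum_rank (diagram i j) : nat); split.
- move=> i j iN jW; split; first exact: ltn_ord.
  rewrite /cell_ok /= tile_ofK; apply/and5P; split.
  + apply/andP; split.
      case: (ltnP i (size s)) => si; first by have [a [_ _ ->]] := act_some si.
      by rewrite [tmoves _](trans_nil si) orbT.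
    apply/forallP => t; apply/implyP; rewrite diagram_mark diagram_sym => /eqP/mark2 ->.
    by rewrite cell_head /treads /= ffunE.
  + apply/implyP => /eqP->; apply/forallP => t; rewrite diagram_mark /mark.
    by do !case: ifP => //; lia.
  + apply/implyP => /eqP jE; apply/forallP => t; rewrite diagram_mark /mark.
    by have := head_pos_bound t iN; do !case: ifP => //; lia.
  + apply/implyP => /eqP iE; have si : size s <= i by lia.
    by rewrite [tmoves _](trans_nil si) /tstate /= conf_last.
  + apply/implyP => /eqP->; apply/andP; split; first exact: eqxx.
    apply/forallP => t; apply/andP; split.
      rewrite diagram_mark /=; case: (eqVneq j N) => [->|jN]; first by rewrite mark_id.
      by have -> : (mark N j == 2) = false by apply/eqP => /mark2 e; rewrite e eqxx in jN.
    rewrite diagram_sym /= code_symP ffunE /cell /= nth_nil.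
    by case: (t == ord0); case: ifP; rewrite ?nth_nil.
- move=> i j iN jW; rewrite /= !tile_ofK; apply/and4P; split; try exact: eqxx.
  by apply/forallP => t; rewrite !diagram_mark mark_nextP.
- move=> i j iN jW; rewrite /= !tile_ofK /tile_v diagram_action.
  case: (ltnP i (size s)) => si; last first.
    have [E cE] := act_none si; rewrite E /tstate /= cE eqxx.
    apply/forallP => t; rewrite !diagram_sym cE /= E eqxx /=.
    by apply/eqP/val_inj; rewrite /= !diagram_mark /= E.
  have [a [E cE _]] := act_some si; rewrite E /tstate /= cE eqxx.
  have shiftE t : head_pos i.+1 t = shift (head_pos i t) (a.2 t).2 by rewrite /= E.
  apply/forallP => t; have p0 : 0 < head_pos i t.
    by have := head_pos_bound t (ltnW iN); lia.
  rewrite !diagram_sym !diagram_mark cE shiftE /= ffunE cell_write //.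
  case: (eqVneq j (head_pos i t)) => [->|jp].
    by rewrite mark_id eqxx eqxx shift_markP ?eqxx.
  by case: eqP => [/mark2 e|//]; rewrite e eqxx in jp.
Qed.

End Complete.

(** One row more than the bound on the number of steps makes room for every computation and for its
    halted configuration in the last row. *)
Lemma NP_tiling (p : {poly nat}) (L : seq bool -> Prop) c :
  (forall x (s : seq (config M)), computation x s -> size s <= (p.[size x])%R) ->
  (forall x, L x <-> accepts M x) ->
  (forall n : nat, (p.[n])%R <= (n + 2) ^ c) ->
  forall x, L x <-> exists f, tiling machine_tiles x ((size x + 2) ^ c + 1) f.
Proof.
move=> Hp HL Hc x; rewrite HL; split.
  move=> [s [H1 H2 H3]]; apply: (accepts_tiling H1 H2 H3).
  by rewrite addn1 ltnS; apply: leq_trans (Hp x s H1) (Hc _).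
by move=> [f Hf]; apply: tiling_accepts Hf; rewrite addn1.
Qed.

End Diagram.

Lemma restricted_NP_hard : NP_hard restricted_TDS.
Proof.
move=> L [M [p [Hp HL]]]; have [c Hc] := poly_nat_bound p.
apply: (@tiling_NP_hard (machine_tiles M) (fun x => (size x + 2) ^ c + 1)
  (ESucc (EPow (EAdd ELen (EConst 2)) c))).
- by move=> x u v; rewrite eval_succ eval_pow addn1.
- by apply/card_gt0P; exists (tile0 M).
- by move=> x; rewrite addn1.
- exact: NP_tiling Hp HL Hc.
Qed.

Theorem theorem3p2 :
  NP_hard TimelineDominatingSet /\
  NP_hard (@restrict TimelineDominatingSet (fun I : tds_instance =>
    [/\ lifetime I = 35, activity I = 3, maxlen I = 6
      & max_snapshot_degree (graph I) <= 1])).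
Proof.
split; last exact: restricted_NP_hard.
(* A restricted instance is an instance with the same encoding, so the same reduction serves. *)
move=> L /restricted_NP_hard[f Hf H]; exists f => // x.
by have [[I HI] [E yesI]] := H x; exists I.
Qed.
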